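(* The families of planes (i) $\{(x,y,z)\in E(1,1): x+c=0\}$, $c\in\mathbb{R}$; (ii) $\{(x,y,z)\in E(1,1): y+c=0\}$, $c\in\mathbb{R}$; (iii) $\{(x,y,z)\in E(1,1): z+c=0\}$, $c\in\mathbb{R}$; are area-stationary, foliated by sub-Riemannian geodesics, and area-minimizing.
   Context: $E(1,1)$ denotes $\mathbb{R}^3$ with coordinates $(x,y,z)$ and the left-invariant vector fields $X=\partial_z$, $Y=\frac{1}{\sqrt2}(-e^{z}\partial_x+e^{-z}\partial_y)$, $T=\frac{1}{\sqrt2}(e^{z}\partial_x+e^{-z}\partial_y)$, with the Riemannian metric $\langle\cdot,\cdot\rangle$ making $\{X,Y,T\}$ orthonormal. The horizontal distribution is $\mathcal{H}=\mathrm{span}\{X,Y\}$, and $J$ is defined on $\mathcal{H}$ by $J(X)=Y$, $J(Y)=-X$. The pseudo-hermitian connection $\nabla$ is the metric connection with $T$ parallel and $\nabla_XX=\nabla_YX=\nabla_XY=\nabla_YY=0$, $\nabla_TX=\frac12Y$, $\nabla_TY=-\frac12X$. The pseudo-hermitian torsion $\tau$ is the linear map with $\tau(X)=-\frac12Y$, $\tau(Y)=-\frac12X$, $\tau(T)=0$. A characteristic curve of (constant) curvature $H$ is an arc-length parametrized curve $\gamma$ tangent to $\mathcal{H}$ with $\nabla_{\dot\gamma}\dot\gamma+HJ(\dot\gamma)=0$. A characteristic curve $\gamma$ is a sub-Riemannian geodesic if and only if $H=0$ and $\langle\tau(\dot\gamma),\dot\gamma\rangle=0$, i.e. (up to orientation)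 if and only if it is an integral curve of $X$ or of $Y$. For a surface $\Sigma$ with Riemannian unit normal $N$, $N_h$ is the orthogonal projection of $N$ onto $\mathcal{H}$; the singular set $\Sigma_0$ is the set of points where the tangent plane of $\Sigma$ equals $\mathcal{H}$. On $\Sigma-\Sigma_0$ put $\nu_h=N_h/|N_h|$ and $Z=J(\nu_h)$; the surface is foliated there by the integral curves of $Z$, and ''foliated by sub-Riemannian geodesics'' means that these curves are sub-Riemannian geodesics. The sub-Riemannian area is $A(\Sigma)=\int_\Sigma|N_h|\,d\Sigma$, with $d\Sigma$ the Riemannian area element. $\Sigma$ is area-stationary if it is a critical point of $A$ under compactly supported deformations, and area-minimizing if $A(\Sigma)\le A(\tilde\Sigma)$ for any compact deformation $\tilde\Sigma$ of $\Sigma$ (areas being compared on the compact region where the surfaces differ). *)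

(* Defs.v *)
From HB Require Import structures.
From mathcomp Require Import all_boot all_order all_algebra.
From mathcomp Require Import all_classical all_reals all_analysis.
From mathcomp Require Import ring.
Set Implicit Arguments.
Unset Strict Implicit.
Unset Printing Implicit Defensive.
Import Order.TTheory GRing.Theory Num.Theory.
Import numFieldNormedType.Exports.
Local Open Scope classical_set_scope.
Local Open Scope ring_scope.

(* Points of E(1,1) and coordinate vectors are triples ((x, y), z). The same
   type also serves for the components (a, b, c) of a X + b Y + c T. *)
Notation E11 R := ((R * R) * R)%type.
Notation frame_vec R := ((R * R) * R)%type.

Section SubRiemannianSol.
Variable R : realType.
Implicit Types (p v w : E11 R) (u : frame_vec R).

Definition fieldX p : E11 R := (0, 0, 1).
Definition fieldY p : E11 R :=
  (- expR p.2 / Num.sqrt 2, expR (- p.2) / Num.sqrt 2, 0).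
Definition fieldT p : E11 R :=
  (expR p.2 / Num.sqrt 2, expR (- p.2) / Num.sqrt 2, 0).

Definition frame p v : frame_vec R :=
  (v.2,
   (- expR (- p.2) * v.1.1 + expR p.2 * v.1.2) / Num.sqrt 2,
   (expR (- p.2) * v.1.1 + expR p.2 * v.1.2) / Num.sqrt 2).

Lemma frameE p v :
  v = (frame p v).1.1 *: fieldX p + (frame p v).1.2 *: fieldY p
      + (frame p v).2 *: fieldT p.
Proof.
have s2 : Num.sqrt 2 * Num.sqrt 2 = 2 :> R by rewrite -expr2 sqr_sqrtr.
have e0 : expR p.2 != 0 by rewrite gt_eqF// expR_gt0.
case: v => [[a b] c]; rewrite /frame /fieldX /fieldY /fieldT /= expRN.
have divs (k l : R) : k / Num.sqrt 2 * (l / Num.sqrt 2) = k * l / 2.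
  by rewrite mulrACA -invfM s2.
have add3 (a1 b1 c1 a2 b2 c2 : R) :
  ((a1, b1), c1) + ((a2, b2), c2) = ((a1 + a2, b1 + b2), c1 + c2) by [].
have scale3 (k a1 b1 c1 : R) :
  k *: ((a1, b1), c1) = ((k * a1, k * b1), k * c1) by [].
rewrite !scale3 !add3; congr ((_, _), _).
- by rewrite /= !divs; field.
- by rewrite /= !divs; field.
- by rewrite /=; ring.
Qed.

(* {X, Y, T} is orthonormal. *)
Definition dot u1 u2 : R := u1.1.1 * u2.1.1 + u1.1.2 * u2.1.2 + u1.2 * u2.2.
Definition norm u : R := Num.sqrt (dot u u).
Definition cross u1 u2 : frame_vec R :=
  (u1.1.2 * u2.2 - u1.2 * u2.1.2,
   u1.2 * u2.1.1 - u1.1.1 * u2.2,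
   u1.1.1 * u2.1.2 - u1.1.2 * u2.1.1).

Definition horizontal u : Prop := u.2 = 0.
Definition hproj u : frame_vec R := (u.1.1, u.1.2, 0).
Definition J u : frame_vec R := (- u.1.2, u.1.1, 0).
Definition tau u : frame_vec R := (- (u.1.2 / 2), - (u.1.1 / 2), 0).

(* nabla_u w for w with constant components in the frame: T is parallel,
   nabla_T X = Y / 2, nabla_T Y = - X / 2, and nabla_X, nabla_Y vanish. *)
Definition connection u w : frame_vec R :=
  u.2 *: (- (w.1.2 / 2), w.1.1 / 2, 0).

Definition velocity (g : R -> E11 R) (t : R) : frame_vec R :=
  frame (g t) ('D_1 g t).

Definition covariant_derivative (g : R -> E11 R) (V : R -> frame_vec R)
    (t : R) : frame_vec R :=
  'D_1 V t + connection (velocity g t) (V t).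

Definition characteristic_curve (H : R) (I : set R) (g : R -> E11 R) : Prop :=
  forall t, I t ->
    [/\ derivable g t 1, derivable (velocity g) t 1,
        norm (velocity g t) = 1, horizontal (velocity g t)
      & covariant_derivative g (velocity g) t + H *: J (velocity g t) = 0].

(* A characteristic curve is a sub-Riemannian geodesic exactly when its
   curvature H is 0 and <tau(g'), g'> = 0. *)
Definition sr_geodesic (I : set R) (g : R -> E11 R) : Prop :=
  characteristic_curve 0 I g /\
  forall t, I t -> dot (tau (velocity g t)) (velocity g t) = 0.

(* In finite dimension this is the usual class C^k. *)
Fixpoint class_C (k : nat) (V W : normedModType R) (F : V -> W) : Prop :=
  if k is k'.+1 then
    (forall q, differentiable F q) /\ (forall d : V, class_C k' ('D_d F))
  else continuous F.

Section Maps.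
Variable F : R * R -> E11 R.

Definition immersion : Prop := forall q, injective ('d F q).

Definition tangent1 (q : R * R) : frame_vec R := frame (F q) ('D_(1, 0) F q).
Definition tangent2 (q : R * R) : frame_vec R := frame (F q) ('D_(0, 1) F q).

Definition unit_normal (q : R * R) : frame_vec R :=
  (norm (cross (tangent1 q) (tangent2 q)))^-1
    *: cross (tangent1 q) (tangent2 q).
Definition Nh (q : R * R) : frame_vec R := hproj (unit_normal q).

Definition area_element (q : R * R) : R :=
  Num.sqrt (dot (tangent1 q) (tangent1 q) * dot (tangent2 q) (tangent2 q)
            - dot (tangent1 q) (tangent2 q) ^+ 2).

Definition sr_area (K : set (R * R)) : \bar R :=
  (\int[lebesgue_measure \x lebesgue_measure]_(q in K)
     (norm (Nh q) * area_element q)%:E)%E.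

Definition singular (q : R * R) : Prop :=
  frame (F q) @` range ('d F q) = [set u | horizontal u].

Definition nu_h (q : R * R) : frame_vec R := (norm (Nh q))^-1 *: Nh q.
Definition Z (q : R * R) : frame_vec R := J (nu_h q).

Definition integral_curve_Z (I : set R) (g : R -> E11 R) : Prop :=
  [/\ open I, is_interval I &
      forall t, I t -> derivable g t 1 /\
        exists q, [/\ g t = F q, ~ singular q & velocity g t = Z q]].

End Maps.

(* C^2 surfaces that are embedded copies of the plane; for such a surface a
   parametrization is a C^2 immersion that is a homeomorphism onto S. *)
Definition parametrizes (f : R * R -> E11 R) (S : set (E11 R)) : Prop :=
  [/\ class_C 2 f, immersion f, range f = S &
      exists2 h : E11 R -> R * R, {within S, continuous h} & cancel f h].

Definition plane_surface (S : set (E11 R)) : Prop :=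
  exists f, parametrizes f S.

(* The notions below do not depend on the parametrization, so they are
   required of all of them; both choices of the unit normal N occur. *)
Definition foliated_by_sr_geodesics (S : set (E11 R)) : Prop :=
  plane_surface S /\
  forall f, parametrizes f S ->
    (forall q, ~ singular f q ->
       exists I g, [/\ integral_curve_Z f I g, I 0 & g 0 = f q]) /\
    (forall I g, integral_curve_Z f I g -> sr_geodesic I g).

(* C^1 is the least regularity for which the area is defined; competitors are
   immersed surfaces and need not be joined to f through immersions. *)
Definition compact_deformation (f : R * R -> E11 R) (K : set (R * R))
    (F : R * R -> E11 R) : Prop :=
  [/\ class_C 1 F, immersion F & forall q, ~ K q -> F q = f q].

Definition variation (f : R * R -> E11 R) (K : set (R * R))
    (phi : R -> R * R -> E11 R) : Prop :=
  [/\ class_C 2 (fun tq : R * (R * R) => phi tq.1 tq.2),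
      phi 0 = f & forall t, compact_deformation f K (phi t)].

Definition area_stationary (S : set (E11 R)) : Prop :=
  plane_surface S /\
  forall f, parametrizes f S ->
  forall K phi, compact K -> variation f K phi ->
    is_derive (0 : R) 1 (fun t => fine (sr_area (phi t) K)) 0.

Definition area_minimizing (S : set (E11 R)) : Prop :=
  plane_surface S /\
  forall f, parametrizes f S ->
  forall K F, compact K -> compact_deformation f K F ->
    (sr_area f K <= sr_area F K)%E.

End SubRiemannianSol.

(* Main.v *)
Require Import Defs.
From mathcomp Require Import all_boot all_order all_algebra.
From mathcomp Require Import all_classical all_reals all_analysis.
From mathcomp Require Import measurable_realfun.
From mathcomp Require Import ring lra.
Set Implicit Arguments.
Unset Strict Implicit.
Unset Printing Implicit Defensive.
Import Order.TTheory GRing.Theory Num.Theory.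
Import numFieldNormedType.Exports.
Local Open Scope classical_set_scope.
Local Open Scope ring_scope.

(** The planes are calibrated by horizontal fields with constant coefficients in
    the frame. Write vol for the Riemannian volume form and, for a unit
    vector e = (e1, e2), let V = e1 X + e2 Y. The two-form i_V vol is closed,
    because X and Y are divergence-free; explicitly
      i_X vol = - dx /\ dy,
      i_Y vol = (dy /\ d(exp z) - dx /\ d(exp (- z))) / sqrt 2.
    Along any immersed surface the sub-Riemannian area density is the length of
    the vector (i_X vol, i_Y vol) (lemma [area_densityE]), so by Cauchy-Schwarz
    it is at least i_V vol, with equality where the horizontal normal points in
    the direction V. A surface whose horizontal normal is V everywhere is called
    calibrated by e. If F agrees with such a surface f outside a compact set K,
    then by Stokes' theorem

      area of f = int_K i_V vol(f) = int_K i_V vol(F) <= area of F,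

    which is [calibrated_minimizing].

    Each of the planes is calibrated: the coordinate which is constant kills one
    of the two forms, and immersivity forbids the other one to vanish, so that
    it has a constant sign. Hence e = (0, 1) or (0, -1) when x or y is constant,
    and e = (1, 0) or (-1, 0) when z is constant.

    Stationarity is a quantitative form of the same inequality. For a variation
    phi_t of f, the vector (i_X vol, i_Y vol) along phi_t is at distance O(t)
    from its value along f, which is a multiple of e bounded away from 0. The
    defect between its length and its component along e is then O(t^2), and
    A(phi_t) - A(f) is the integral of this defect over K; being O(t^2), it has
    derivative 0 at t = 0 ([calibrated_stationary]).

    Finally Z = J(e) = - e2 X + e1 Y has constant coefficients, so the velocity
    of an integral curve of Z is constant in the frame; it solves the geodesic
    equation because T is orthogonal to it, and the torsion term is a multiple
    of e1 e2 = 0 ([calibrated_geodesic]).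

    The delicate point is Stokes' theorem, since competitors are only of class
    C^1 and the forms da /\ dv cannot be differentiated. It is obtained from the
    function Q(x) = int a(x, y) (dv/dy)(x, y) dy, whose derivative is
    int (da /\ dv)(x, y) dy: the increments of Q are integrated by parts in y
    before the limit is taken, so that only first derivatives occur. *)

(** * Maps of class C^k *)

Section Continuity.
Variable R : realType.
Implicit Types T : topologicalType.

Lemma continuous_add T (f g : T -> R) :
  continuous f -> continuous g -> continuous (fun y => f y + g y).
Proof. by move=> cf cg y; apply: cvgD; [exact: cf|exact: cg]. Qed.

Lemma continuous_sub T (f g : T -> R) :
  continuous f -> continuous g -> continuous (fun y => f y - g y).
Proof. by move=> cf cg y; apply: cvgB; [exact: cf|exact: cg]. Qed.

Lemma continuous_mul T (f g : T -> R) :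
  continuous f -> continuous g -> continuous (fun y => f y * g y).
Proof. by move=> cf cg y; apply: cvgM; [exact: cf|exact: cg]. Qed.

Lemma continuous_cst T (k : R) : continuous (fun _ : T => k).
Proof. by move=> y; exact: cvg_cst. Qed.

Lemma continuous_slice T (U S : topologicalType) (f : T * U -> S) x :
  continuous f -> continuous (fun y => f (x, y)).
Proof.
move=> cf y; apply: (@continuous_comp _ _ _ (fun y => (x, y)) f); last exact: cf.
by apply: cvg_pair; [exact: cvg_cst|exact: cvg_id].
Qed.

End Continuity.

Section ClassC1.
Variable R : realType.
Implicit Types V W U : normedModType R.

Lemma class_C1_continuous V W (F : V -> W) : class_C 1 F -> continuous F.
Proof. by move=> [dF _] q; exact/differentiable_continuous. Qed.

Lemma class_C2_C1 V W (F : V -> W) : class_C 2 F -> class_C 1 F.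
Proof. by move=> [dF CF]; split=> // d; exact/class_C1_continuous/CF. Qed.

Lemma class_C_cst V W k (w : W) : class_C k (fun _ : V => w).
Proof.
elim: k w => [|k IH] w; first by move=> q; exact: cvg_cst.
split=> [q|d]; first exact: differentiable_cst.
rewrite (_ : 'D_d _ = fun=> 0); first exact: IH.
by apply/funext => q; rewrite derive_cst.
Qed.

Lemma class_C_id V k : class_C k (@id V).
Proof.
case: k => [|k]; first by move=> q; exact: cvg_id.
split=> [q|d]; first exact: ex_diff.
rewrite (_ : 'D_d _ = fun=> d); first exact: class_C_cst.
by apply/funext => q; rewrite derive_id.
Qed.

Lemma class_C_pair V W U k (f : V -> W) (g : V -> U) :
  class_C k f -> class_C k g -> class_C k (fun q => (f q, g q)).
Proof.
elim: k f g => [|k IH] f g.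
  by move=> cf cg q; apply: cvg_pair; [exact: cf|exact: cg].
move=> [df Cf] [dg Cg]; split=> [q|d]; first exact: differentiable_pair.
rewrite (_ : 'D_d _ = fun q => ('D_d f q, 'D_d g q)).
  by apply: IH; [exact: Cf|exact: Cg].
apply/funext => q; rewrite !deriveE//; last exact: differentiable_pair.
by rewrite diff_pair.
Qed.

Lemma class_C1D V W (f g : V -> W) :
  class_C 1 f -> class_C 1 g -> class_C 1 (fun q => f q + g q).
Proof.
move=> [df cf] [dg cg]; split=> [q|d]; first exact: differentiableD.
rewrite (_ : 'D_d _ = fun q => 'D_d f q + 'D_d g q).
  by move=> q; apply: cvgD; [exact: cf|exact: cg].
by apply/funext => q; rewrite [LHS]deriveD//; exact: diff_derivable.
Qed.

Lemma class_C1M V (f g : V -> R) :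
  class_C 1 f -> class_C 1 g -> class_C 1 (fun q => f q * g q).
Proof.
move=> [df cf] [dg cg]; split=> [q|d]; first exact: differentiableM.
rewrite (_ : 'D_d _ = fun q => f q * 'D_d g q + g q * 'D_d f q).
  move=> q; apply: cvgD; apply: cvgM.
  - exact/differentiable_continuous.
  - exact: cg.
  - exact/differentiable_continuous.
  - exact: cf.
by apply/funext => q; rewrite [LHS]deriveM//; exact: diff_derivable.
Qed.

Lemma class_C1N V (f : V -> R) : class_C 1 f -> class_C 1 (fun q => - f q).
Proof.
move=> Cf; rewrite (_ : (fun _ => _) = fun q => (-1) * f q).
  by apply: class_C1M => //; exact: class_C_cst.
by apply/funext => q; rewrite mulN1r.
Qed.

Lemma derive_expR_comp V (f : V -> R) d q : differentiable f q ->
  'D_d (fun q => expR (f q)) q = expR (f q) * 'D_d f q.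
Proof.
move=> df.
have de : differentiable (@expR R) (f q) by exact/derivable1_diffP.
rewrite !deriveE//; last exact: differentiable_comp.
by rewrite diff_comp//= deriv1E// derive1E derive_val mulrC.
Qed.

Lemma class_C1_expR V (f : V -> R) :
  class_C 1 f -> class_C 1 (fun q => expR (f q)).
Proof.
move=> [df cf]; split=> [q|d].
  by apply: differentiable_comp => //; exact/derivable1_diffP.
rewrite (_ : 'D_d _ = fun q => expR (f q) * 'D_d f q).
  move=> q; apply: cvgM; last exact: cf.
  by apply: continuous_comp; [exact/differentiable_continuous|exact: continuous_expR].
by apply/funext => q; rewrite derive_expR_comp.
Qed.

Lemma derive_lin_comp V W U (L : {linear W -> U}) (F : V -> W) d q :
  continuous L -> differentiable F q ->
  'D_d (fun q => L (F q)) q = L ('D_d F q).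
Proof.
move=> cL dF; have dL := linear_differentiable (F q) cL.
rewrite !deriveE//; last exact: differentiable_comp.
by rewrite diff_comp//= diff_lin.
Qed.

Lemma class_C_lin V W U k (L : {linear W -> U}) (F : V -> W) :
  continuous L -> class_C k F -> class_C k (fun q => L (F q)).
Proof.
move=> cL; elim: k F => [|k IH] F /=.
  by move=> cF q; apply: continuous_comp; [exact: cF|exact: cL].
move=> [dF CF]; split=> [q|d].
  by apply: differentiable_comp => //; exact: linear_differentiable.
rewrite (_ : 'D_d _ = fun q => L ('D_d F q)); first exact: IH.
by apply/funext => q; rewrite derive_lin_comp.
Qed.

Lemma fst_continuous V W : continuous (@fst V W).
Proof. by move=> p; exact: cvg_fst. Qed.

Lemma snd_continuous V W : continuous (@snd V W).
Proof. by move=> p; exact: cvg_snd. Qed.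

Lemma class_C_fst V W U k (F : V -> W * U) :
  class_C k F -> class_C k (fun q => (F q).1).
Proof. exact: (class_C_lin (L := fst) (@fst_continuous W U)). Qed.

Lemma class_C_snd V W U k (F : V -> W * U) :
  class_C k F -> class_C k (fun q => (F q).2).
Proof. exact: (class_C_lin (L := snd) (@snd_continuous W U)). Qed.

Lemma differentiable_fst V W U (F : V -> W * U) q :
  differentiable F q -> differentiable (fun q => (F q).1) q.
Proof.
move=> dF; apply: (differentiable_comp dF).
exact: linear_differentiable (@fst_continuous W U).
Qed.

Lemma derive_fst V W U (F : V -> W * U) d q : differentiable F q ->
  'D_d (fun q => (F q).1) q = ('D_d F q).1.
Proof. exact: (derive_lin_comp (L := fst) d (@fst_continuous W U)). Qed.

Lemma derive_snd V W U (F : V -> W * U) d q : differentiable F q ->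
  'D_d (fun q => (F q).2) q = ('D_d F q).2.
Proof. exact: (derive_lin_comp (L := snd) d (@snd_continuous W U)). Qed.

End ClassC1.

(** * Lebesgue integration on the plane *)

Section PlaneIntegral.
Variable R : realType.
Notation leb := (@lebesgue_measure R).
Notation leb2 := (leb \x leb)%E.
Implicit Types (f g : R * R -> R) (K : set (R * R)).

(** An open set is the union of the open boxes with rational corners that it
    contains, and there are countably many of them. *)
Lemma open_measurable_plane (U : set (R * R)) : open U ->
  measurable (U : set (measurableTypeR R * measurableTypeR R)).
Proof.
move=> oU.
pose box (i : (rat * rat) * (rat * rat)) : set (R * R) :=
  `]ratr i.1.1, ratr i.1.2[%classic `*` `]ratr i.2.1, ratr i.2.2[%classic.
have -> : U = \bigcup_i (if asbool (box i `<=` U) then box i else set0).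
  apply/seteqP; split=> [p Up|p [i _]]; last first.
    by case: asboolP => [sub bp|_ []//]; exact: sub.
  have /nbhs_ballP[e /= e0 eU] : nbhs p U by exact: open_nbhs_nbhs.
  have h1 (x : R) : x - e < x by rewrite ltrBlDr ltrDl.
  have h2 (x : R) : x < x + e by rewrite ltrDl.
  have [a1] := rat_in_itvoo (h1 p.1); have [b1] := rat_in_itvoo (h2 p.1).
  have [a2] := rat_in_itvoo (h1 p.2); have [b2] := rat_in_itvoo (h2 p.2).
  rewrite !in_itv/= => /andP[pb2 b2e] /andP[a2e a2p] /andP[pb1 b1e] /andP[a1e a1p].
  exists ((a1, b1), (a2, b2)) => //; case: asboolP => [_|[]].
    by rewrite /box/= !in_itv/= a1p pb1 a2p pb2.
  move=> [x y]; rewrite /box/= !in_itv/= => -[/andP[? ?] /andP[? ?]].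
  by apply: eU; split; rewrite /ball/= ltr_norml; apply/andP; split; lra.
apply: countable_bigcupT_measurable => // i; case: asboolP => // _.
by apply: measurableX; exact: measurable_itv.
Qed.

Lemma continuous_measurable_plane f : continuous f ->
  measurable_fun [set: measurableTypeR R * measurableTypeR R] f.
Proof.
move=> cf; apply: (measurability _ (RGenOInfty.measurableE R)) => // _ [_ [x ->] <-].
rewrite setTI; apply: open_measurable_plane.
apply: open_comp; [by move=> q _; exact: cf|exact: interval_open].
Qed.

Lemma compact_measurable_plane K : compact K ->
  measurable (K : set (measurableTypeR R * measurableTypeR R)).
Proof.
move=> cK; rewrite -(setCK K); apply: measurableC; apply: open_measurable_plane.
by rewrite openC; apply: compact_closed => //; exact: norm_hausdorff.
Qed.

Lemma compact_sub_box K : compact K ->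
  exists2 M : R, 0 < M & K `<=` `]-M, M[ `*` `]-M, M[.
Proof.
move=> /compact_bounded[N [_ N1x]].
exists (`|N| + 1 + 1) => [|p Kp]; first by rewrite addr_gt0// ltr_pwDr.
have := N1x (`|N| + 1); rewrite ltr_pwDr// ?ler_norm// => /(_ isT _ Kp).
rewrite /= prod_normE ge_max => /andP[p1 p2].
split; rewrite /= in_itv/= -ltr_norml.
  by rewrite (le_lt_trans p1)// ltrDl.
by rewrite (le_lt_trans p2)// ltrDl.
Qed.

Lemma compact_finite_measure_plane K : compact K -> (leb2 K < +oo)%E.
Proof.
move=> cK; have [M M0 KM] := compact_sub_box cK.
rewrite (@le_lt_trans _ _ (leb2 (`]-M, M[ `*` `]-M, M[)))//.
  apply: le_measure; rewrite ?inE//; first exact: compact_measurable_plane.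
  by apply: measurableX; exact: measurable_itv.
rewrite product_measure1E//= lebesgue_measure_itv/=.
by case: ifP => _; rewrite ?mule0 // -EFinM ltry.
Qed.

Lemma continuous_compact_integrable_plane f K : continuous f -> compact K ->
  leb2.-integrable K (EFin \o f).
Proof.
move=> cf cK; have mK := compact_measurable_plane cK.
apply: measurable_bounded_integrable => //.
- exact: compact_finite_measure_plane.
- by apply: measurable_funS (continuous_measurable_plane cf).
- have /compact_bounded[M [_ mrt]] := continuous_compact (continuous_subspaceT cf) cK.
  by exists M; split; rewrite ?num_real // => ? ? ? ?; exact: mrt.
Qed.

End PlaneIntegral.

(** * One-variable calculus and parametric integrals *)

Section Line.
Variable R : realType.

Lemma is_derive_line (V W : normedModType R) (F : V -> W) (p d : V) (t : R) :
  differentiable F (t *: d + p) ->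
  is_derive t 1 (fun s : R => F (s *: d + p)) ('D_d F (t *: d + p)).
Proof.
move=> dF; have DF := diff_derivable (v := d) dF.
have e : (fun h : R => h^-1 *: (F ((h *: (1 : R^o) + t) *: d + p) - F (t *: d + p)))
       = (fun h => h^-1 *: (F (h *: d + (t *: d + p)) - F (t *: d + p))).
  by apply/funext => h; rewrite scalerDl addrA /GRing.scale/= mulr1.
apply: DeriveDef; first by rewrite /derivable/= e.
by rewrite /derive/= e.
Qed.

Lemma is_derive_fst_var (F : R * R -> R) (x y : R) : differentiable F (x, y) ->
  is_derive x 1 (fun x => F (x, y)) ('D_(1, 0) F (x, y)).
Proof.
have e (s : R) : (s, y) = s *: (1, 0) + (0, y).
  by congr pair => /=; [rewrite [_ *: _]mulr1 addr0|rewrite scaler0 add0r].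
rewrite (e x) => /is_derive_line; set G := fun s : R => _.
by rewrite (_ : G = fun s => F (s, y)) //; apply/funext => s; rewrite e.
Qed.

Lemma is_derive_snd_var (F : R * R -> R) (x y : R) : differentiable F (x, y) ->
  is_derive y 1 (fun y => F (x, y)) ('D_(0, 1) F (x, y)).
Proof.
have e (s : R) : (x, s) = s *: (0, 1) + (x, 0).
  by congr pair => /=; [rewrite scaler0 add0r|rewrite [_ *: _]mulr1 addr0].
rewrite (e y) => /is_derive_line; set G := fun s : R => _.
by rewrite (_ : G = fun s => F (x, s)) //; apply/funext => s; rewrite e.
Qed.

Lemma is_derive_continuous (f df : R -> R) :
  (forall s : R, is_derive s 1 f (df s)) -> continuous f.
Proof.
by move=> fdf s; apply/differentiable_continuous/derivable1_diffP; have [] := fdf s.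
Qed.

(** The mean value theorem for increments of either sign, with the intermediate
    point located relative to x, as limits at h = 0 require. *)
Lemma MVT_increment (f df : R -> R) (x h : R) :
  (forall s : R, is_derive s 1 f (df s)) ->
  exists2 c, `|c| <= `|h| & f (h + x) - f x = h * df (c + x).
Proof.
move=> fdf.
have cf := is_derive_continuous fdf.
have [h0|h0] := leP 0 h.
  have xh : x <= h + x by rewrite lerDr.
  have [c] := MVT_segment xh (fun s _ => fdf s) (continuous_subspaceT cf).
  rewrite in_itv/= => /andP[xc ch] ->; exists (c - x); last by rewrite addrK subrK mulrC.
  by rewrite !ger0_norm ?subr_ge0// lerBlDr.
have hx : h + x <= x by rewrite gerDr ltW.
have [c] := MVT_segment hx (fun s _ => fdf s) (continuous_subspaceT cf).
rewrite in_itv/= => /andP[hc cx] e; exists (c - x); last first.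
  by rewrite subrK -opprB e opprD addrC subrK; ring.
by rewrite !ler0_norm ?subr_le0// ?(ltW h0)// lerN2 lerBrDr.
Qed.

End Line.

Section ParametricIntegral.
Variable R : realType.
Notation leb := (@lebesgue_measure R).
Variables (a b : R).
Hypothesis ab : a < b.
Notation I := (`[a, b]%classic : set R).

Lemma continuous_integrable_segment (f : R -> R) : continuous f ->
  leb.-integrable I (EFin \o f).
Proof.
move=> cf; apply: continuous_compact_integrable; first exact: segment_compact.
exact: continuous_subspaceT.
Qed.

(** Joint convergence at every point of the segment is locally uniform in y, so
    by compactness it is uniform, and the limit passes under the integral. *)
Lemma cvg_Rintegral_segment (T : Type) (F : set_system T)
    (E : T -> R -> R) (g : R -> R) :
  Filter F -> (forall i, continuous (E i)) -> continuous g ->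
  (forall y, I y -> (fun yi => E yi.2 yi.1) @ filter_prod (nbhs y) F --> g y) ->
  (fun i => \int[leb]_(y in I) E i y) @ F --> \int[leb]_(y in I) g y.
Proof.
move=> FF cE cg Eg; apply/cvgrPdist_le => e e0.
pose d := e / (b - a).
have d0 : 0 < d by rewrite divr_gt0// subr_gt0.
have /compact_near_coveringP cI := @segment_compact R a b.
have : \forall i \near F, I `<=` (fun i y => `|g y - E i y| <= d) i.
  apply: cI => y Iy.
  have hd : 0 < d / 2 by rewrite divr_gt0.
  have Eg' := Eg y Iy; move/cvgrPdist_le : Eg' => /(_ _ hd) Eg'.
  have gg : \forall y' \near y, `|g y - g y'| <= d / 2.
    by move/cvgrPdist_le : (cg y) => /(_ _ hd).
  have gg' : \forall yi \near filter_prod (nbhs y) F, `|g y - g yi.1| <= d / 2.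
    by exists ([set y' | `|g y - g y'| <= d / 2], setT);
      [split => //; exact: filterT|move=> [y' i] []].
  have FP : Filter (filter_prod (nbhs y) F) by exact: filter_prod_filter.
  apply: (@filterS2 _ _ FP _ _ _ _ Eg' gg') => -[y' i] /= Eh gh.
  rewrite (_ : g y' - _ = (g y - E i y') - (g y - g y')); last by ring.
  rewrite (le_trans (ler_normB _ _))// [leRHS]splitr; exact: lerD.
apply: (@filterS _ _ FF) => i Hi.
have mI : measurable (I : set (measurableTypeR R)) by exact: measurable_itv.
rewrite -(RintegralB mI (continuous_integrable_segment cg)
                        (continuous_integrable_segment (cE i))).
apply: le_trans.
  apply: le_normr_Rintegral => //.
  apply: continuous_integrable_segment => y.
  by apply: cvgB; [exact: cg|exact: cE].
have -> : e = \int[leb]_(y in I) d.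
  rewrite Rintegral_cst//.
  have /= -> := lebesgue_measure_itv `[a, b]%R.
  by rewrite lte_fin ab/= /d divfK// subr_eq0 gt_eqF.
apply: le_Rintegral => //.
- apply: (@continuous_integrable_segment (fun y => `|g y - E i y|)) => y.
  by apply: cvg_norm; apply: cvgB; [exact: cg|exact: cE].
- by apply: (@continuous_integrable_segment (fun=> d)) => y; exact: cvg_cst.
Qed.

End ParametricIntegral.

Section RealLine.
Variable R : realType.

Lemma is_derive_LRcontinuous (f df : R -> R) (x y : R) :
  (forall s : R, is_derive s 1 f (df s)) -> derivable_oo_LRcontinuous f x y.
Proof.
move=> fdf; have cf := is_derive_continuous fdf.
split=> [s _| |]; first by have [] := fdf s.
  exact/cvg_at_right_filter/cf.
exact/cvg_at_left_filter/cf.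
Qed.

Lemma is_derive_derive1 (f df : R -> R) (D : {pred R}) :
  (forall s : R, is_derive s 1 f (df s)) -> {in D, f^`()%classic =1 df}.
Proof. by move=> fdf s _; have ? := fdf s; rewrite derive1E derive_val. Qed.

End RealLine.

(** * Stokes' theorem for functions of class C^1 *)

Section Stokes.
Variable R : realType.
Notation leb := (@lebesgue_measure R).
Notation leb2 := (leb \x leb)%E.
Implicit Types a v : R * R -> R.

(** The coefficient of the two-form da /\ dv. *)
Definition planar_jacobian a v (q : R * R) : R :=
  'D_(1, 0) a q * 'D_(0, 1) v q - 'D_(0, 1) a q * 'D_(1, 0) v q.

Lemma planar_jacobian_continuous a v : class_C 1 a -> class_C 1 v ->
  continuous (planar_jacobian a v).
Proof.
move=> [_ Ca] [_ Cv] q.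
apply: cvgB; apply: cvgM.
- exact: (Ca (1, 0) q).
- exact: (Cv (0, 1) q).
- exact: (Ca (0, 1) q).
- exact: (Cv (1, 0) q).
Qed.

Lemma derive_eq_off (V W : normedModType R) (f g : V -> W) (K : set V) q d :
  closed K -> (forall p, ~ K p -> f p = g p) -> ~ K q -> 'D_d f q = 'D_d g q.
Proof.
move=> cK fg Kq; apply: near_eq_derive.
have oK : open (~` K) by rewrite openC.
by apply: filterS (open_nbhs_nbhs (conj oK Kq)) => p /fg.
Qed.

(** The difference quotient is a value of the continuous partial derivative at a
    nearby point. Letting y move along with h is what
    [cvg_Rintegral_segment] asks for. *)
Lemma cvg_difference_quotient a x y : class_C 1 a ->
  (fun yh : R * R => yh.2^-1 * (a (yh.2 + x, yh.1) - a (x, yh.1)))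
    @ filter_prod (nbhs y) (0 : R)^' --> 'D_(1, 0) a (x, y).
Proof.
move=> [da Ca]; apply/cvgrPdist_le => e e0.
have /cvgrPdist_le/(_ _ e0)/nbhs_ballP[r /= r0 rP] := Ca (1, 0) (x, y).
exists (ball y r, [set h : R | `|h| < r /\ h != 0]).
  split; first exact: nbhsx_ballx.
  rewrite /=; exists r => //= h /=; rewrite sub0r normrN => hr h0; split => //.
move=> [y' h] /= [yy' [hr h0]].
have [c cle ->] := MVT_increment x h (fun s => is_derive_fst_var (da (s, y'))).
rewrite mulrA mulVf// mul1r; apply: rP; split => //.
by rewrite /ball/= opprD addrCA subrr addr0 normrN (le_lt_trans cle).
Qed.

Variables (a v : R * R -> R) (M : R) (K : set (R * R)).
Hypotheses (Ca : class_C 1 a) (Cv : class_C 1 v) (M0 : 0 < M) (cK : compact K).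
Hypothesis KM : K `<=` `]-M, M[ `*` `]-M, M[.
Hypothesis aK : forall q, ~ K q -> a q = 0.
Notation I := (`[- M, M]%classic : set R).

(* For smooth v, differentiating under the integral and integrating by parts
   in y the term which carries the mixed derivative of v turns Q' into G. The
   integrand E of the difference quotients of Q is written so that no second
   derivative of v is involved. *)
Let Q x := \int[leb]_(y in I) (a (x, y) * 'D_(0, 1) v (x, y)).
Let G x := \int[leb]_(y in I) planar_jacobian a v (x, y).

Let a0 x y : ~ (`]-M, M[%classic x /\ `]-M, M[%classic y) -> a (x, y) = 0.
Proof. by move=> xyM; apply: aK => /KM. Qed.

Let MM : - M < M. Proof. by rewrite gtrN. Qed.

Let G_continuous : continuous G.
Proof.
move=> x; apply: cvg_Rintegral_segment => //.
- by move=> i; apply: continuous_slice; exact: planar_jacobian_continuous.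
- by apply: continuous_slice; exact: planar_jacobian_continuous.
- move=> y _; have cJ := planar_jacobian_continuous Ca Cv.
  apply: (@cvg_comp _ _ _ (fun yi : R * R => (yi.2, yi.1))
            (planar_jacobian a v) _ (nbhs (x, y))).
    move=> P [[A B] /= [xA yB] ABP].
    by exists (B, A) => //= -[y' x'] [/= By Ax]; exact: (ABP (x', y')).
  exact: (cJ (x, y)).
Qed.

Let E x h y := h^-1 * (a (h + x, y) - a (x, y)) * 'D_(0, 1) v (h + x, y)
   - 'D_(0, 1) a (x, y) * (h^-1 * (v (h + x, y) - v (x, y))).

Let E_continuous x h : continuous (E x h).
Proof.
have [_ ca] := Ca; have [_ cv] := Cv.
have ca0 := class_C1_continuous Ca; have cv0 := class_C1_continuous Cv.
apply: continuous_sub; apply: continuous_mul.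
- apply: continuous_mul; first exact: continuous_cst.
  apply: continuous_sub.
    exact: (continuous_slice ca0).
  exact: (continuous_slice ca0).
- exact: (continuous_slice (cv (0, 1))).
- exact: (continuous_slice (ca (0, 1))).
- apply: continuous_mul; first exact: continuous_cst.
  apply: continuous_sub.
    exact: (continuous_slice cv0).
  exact: (continuous_slice cv0).
Qed.

(** The increment of a * dv/dy splits into (increment of a) * dv/dy and
    a * (increment of dv/dy); the second part is integrated by parts in y, with
    no boundary term since a vanishes at the ends of the segment. *)
Let increment_Q x h : h^-1 * (Q (h + x) - Q x) = \int[leb]_(y in I) E x h y.
Proof.
have [da ca] := Ca; have [dv cv] := Cv.
have ca0 := class_C1_continuous Ca; have cv0 := class_C1_continuous Cv.
have mI : measurable (I : set (measurableTypeR R)) by exact: measurable_itv.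
have av_cont (s t : R) : continuous (fun y => a (s, y) * 'D_(0, 1) v (t, y)).
  apply: continuous_mul; first exact: (continuous_slice ca0).
  exact: (continuous_slice (cv (0, 1))).
have a2V_cont : continuous
    (fun y => 'D_(0, 1) a (x, y) * (v (h + x, y) - v (x, y))).
  apply: continuous_mul; first exact: (continuous_slice (ca (0, 1))).
  apply: continuous_sub; first exact: (continuous_slice cv0).
  exact: (continuous_slice cv0).
have dA (s : R) := is_derive_snd_var (da (x, s)).
have dV (s : R) : is_derive s 1 (fun y => v (h + x, y) - v (x, y))
    ('D_(0, 1) v (h + x, s) - 'D_(0, 1) v (x, s)).
  have d1 := is_derive_snd_var (dv (h + x, s)).
  have d2 := is_derive_snd_var (dv (x, s)).
  exact: is_deriveB.
have vanish (y : R) : y = M \/ y = - M -> a (x, y) = 0.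
  move=> yM; apply: a0 => -[_]; rewrite /= in_itv/=.
  by case: yM => ->; rewrite ltxx ?andbF.
have parts := Rintegration_by_parts MM
  (continuous_subspaceT (continuous_slice (ca (0, 1))))
  (is_derive_LRcontinuous _ _ dA) (is_derive_derive1 dA)
  (continuous_subspaceT (continuous_sub (continuous_slice (cv (0, 1)))
                                        (continuous_slice (cv (0, 1)))))
  (is_derive_LRcontinuous _ _ dV) (is_derive_derive1 dV).
rewrite (vanish M)// ?(vanish (- M))// in parts; [|by right|by left].
rewrite !mul0r subrr sub0r in parts.
have iI f := @continuous_integrable_segment R (- M) M f.
pose P y := (a (h + x, y) - a (x, y)) * 'D_(0, 1) v (h + x, y).
pose P' y := a (x, y) * ('D_(0, 1) v (h + x, y) - 'D_(0, 1) v (x, y)).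
pose N y := 'D_(0, 1) a (x, y) * (v (h + x, y) - v (x, y)).
have P_cont : continuous P.
  apply: continuous_mul; last exact: (continuous_slice (cv (0, 1))).
  apply: continuous_sub; first exact: (continuous_slice ca0).
  exact: (continuous_slice ca0).
have P'_cont : continuous P'.
  apply: continuous_mul; first exact: (continuous_slice ca0).
  apply: continuous_sub; first exact: (continuous_slice (cv (0, 1))).
  exact: (continuous_slice (cv (0, 1))).
transitivity (h^-1 * \int[leb]_(y in I) (P y - N y)); last first.
  rewrite -(RintegralZl _ mI (iI _ (continuous_sub P_cont a2V_cont))).
  by apply: eq_Rintegral => y _; rewrite /E /P /N; ring.
congr (_ * _).
rewrite (RintegralB mI (iI _ P_cont) (iI _ a2V_cont)) -parts.
rewrite -(RintegralD mI (iI _ P_cont) (iI _ P'_cont)).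
rewrite -(RintegralB mI (iI _ (av_cont _ _)) (iI _ (av_cont _ _))).
by apply: eq_Rintegral => y _; rewrite /P /P'; ring.
Qed.

Let is_derive_Q x : is_derive (x : R) 1 Q (G x).
Proof.
have [_ ca] := Ca; have [_ cv] := Cv.
suff H : (fun h : R => h^-1 * (Q (h + x) - Q x)) @ (0 : R)^' --> G x.
  have e : (fun h : R => h^-1 *: (Q (h *: (1 : R) + x) - Q x)) =
           (fun h : R => h^-1 * (Q (h + x) - Q x)).
    by apply/funext => h; rewrite [h *: 1]mulr1.
  apply: DeriveDef; first by rewrite /derivable e; apply/cvg_ex; exists (G x).
  by rewrite /derive e; apply: cvg_lim.
rewrite (_ : (fun h => _) = fun h => \int[leb]_(y in I) E x h y); last first.
  by apply/funext => h; rewrite increment_Q.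
apply: cvg_Rintegral_segment => //.
- by apply: continuous_slice; exact: planar_jacobian_continuous.
- move=> y _; rewrite /planar_jacobian; apply: cvgB; apply: cvgM.
  + exact: cvg_difference_quotient.
  + apply: cvg_comp (cv (0, 1) (x, y)).
    move=> P [[A B] /= [/nbhs_ballP[r /= r0 rA] yB] ABP].
    exists (B, [set h : R | `|h| < r]).
      by split=> //; exists r => //= h /=; rewrite sub0r normrN.
    move=> [y' h] /= [By hr]; apply: ABP; split => //; apply: rA.
    by rewrite /ball/= opprD addrCA subrr addr0 normrN.
  + apply: cvg_comp (ca (0, 1) (x, y)).
    move=> P [[A B] /= [xA yB] ABP]; exists (B, setT).
      by split => //; exact: filterT.
    move=> [y' h] /= [By _]; apply: (ABP (x, y')); split => //.
    exact: nbhs_singleton.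
  + exact: cvg_difference_quotient.
Qed.

Let integral_G : (\int[leb]_(x in I) (G x)%:E = 0)%E.
Proof.
rewrite (continuous_FTC2 MM (continuous_subspaceT G_continuous)
  (is_derive_LRcontinuous _ _ is_derive_Q) (is_derive_derive1 is_derive_Q)).
have Q0 y : y = M \/ y = - M -> Q y = 0.
  move=> yM; rewrite /Q /Rintegral integral0_eq// => z _.
  rewrite a0 ?mul0r// => -[+ _].
  by rewrite /= in_itv/=; case: yM => ->; rewrite ltxx ?andbF.
by rewrite !Q0 ?subee//; [right|left].
Qed.

Let planar_jacobianK q : ~ K q -> planar_jacobian a v q = 0.
Proof.
move=> Kq; rewrite /planar_jacobian.
have clK : closed K by apply: compact_closed => //; exact: norm_hausdorff.
have D0 d : 'D_d a q = 0.
  by rewrite (derive_eq_off (g := cst 0) d clK aK Kq) derive_cst.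
by rewrite !D0 !mul0r subrr.
Qed.

Let J_cont := planar_jacobian_continuous Ca Cv.

(** By Fubini the integral is that of Q' over the x-axis, and Q vanishes outside
    the box. *)
Lemma integral_planar_jacobian0 :
  (\int[leb2]_(q in K) (planar_jacobian a v q)%:E = 0)%E.
Proof.
have JK : (EFin \o planar_jacobian a v) \_ K = EFin \o planar_jacobian a v.
  apply/funext => q; rewrite patchE; case: ifPn => //= /negP qK.
  by rewrite planar_jacobianK// => Kq; apply: qK; rewrite inE.
rewrite integral_mkcond JK.
have iJ : leb2.-integrable setT (EFin \o planar_jacobian a v).
  rewrite -JK; apply: (iffLR (integrable_mkcond _ (compact_measurable_plane cK))).
  exact: continuous_compact_integrable_plane.
rewrite -(integral12_prod_meas1 iJ)/=.
rewrite -integral_G [RHS]integral_mkcond; apply: eq_integral => x _.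
rewrite /fubini_F/= patchE; case: ifPn => [_|xI].
  transitivity (\int[leb]_(y in I) (planar_jacobian a v (x, y))%:E)%E.
    rewrite [RHS]integral_mkcond; apply: eq_integral => y _.
    rewrite patchE; case: ifPn => // /negP yI.
    rewrite planar_jacobianK// => /KM[_ /= yM]; apply: yI; rewrite inE.
    exact: subset_itv_oo_cc.
  rewrite /G /Rintegral fineK//; apply: integrable_fin_num => //.
  by apply: continuous_integrable_segment => //; exact: (continuous_slice J_cont).
rewrite integral0_eq// => y _; rewrite planar_jacobianK// => /KM[/= xM _].
by move: xI; rewrite notin_setE; apply; exact: subset_itv_oo_cc.
Qed.

End Stokes.

(** * The horizontal flux through a surface *)

Section Flux.
Variable R : realType.
Notation leb2 := ((@lebesgue_measure R) \x (@lebesgue_measure R))%E.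
Implicit Types (a b u v : R * R -> R) (F : R * R -> E11 R).

Lemma planar_jacobianC a b q : planar_jacobian a b q = - planar_jacobian b a q.
Proof. by rewrite /planar_jacobian opprB; congr (_ - _); exact: mulrC. Qed.

Lemma class_C1B a b : class_C 1 a -> class_C 1 b -> class_C 1 (fun q => a q - b q).
Proof. by move=> Ca Cb; apply: class_C1D => //; exact: class_C1N. Qed.

Lemma planar_jacobianBl a b v q : class_C 1 a -> class_C 1 b ->
  planar_jacobian (fun q => a q - b q) v q = planar_jacobian a v q - planar_jacobian b v q.
Proof.
move=> [da _] [db _]; rewrite /planar_jacobian.
have D d : 'D_d (fun q => a q - b q) q = 'D_d a q - 'D_d b q.
  by rewrite [LHS]deriveB//; exact: diff_derivable.
rewrite (D (1, 0)) (D (0, 1)).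
have alg (a1 b1 a2 b2 v1 v2 : R) :
  (a1 - b1) * v2 - (a2 - b2) * v1 = a1 * v2 - a2 * v1 - (b1 * v2 - b2 * v1) by ring.
exact: alg.
Qed.

Lemma Rintegral_planar_jacobian0 a v K : class_C 1 a -> class_C 1 v -> compact K ->
  (forall q, ~ K q -> a q = 0) -> \int[leb2]_(q in K) planar_jacobian a v q = 0.
Proof.
move=> Ca Cv cK aK; have [M M0 KM] := compact_sub_box cK.
by rewrite /Rintegral (integral_planar_jacobian0 Ca Cv M0 cK KM aK).
Qed.

(** The form is bilinear in the pair of functions, so the difference of the two
    sides is a sum of two integrals in each of which one function is supported
    in K. *)
Lemma eq_Rintegral_planar_jacobian a b u v K :
  class_C 1 a -> class_C 1 b -> class_C 1 u -> class_C 1 v -> compact K ->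
  (forall q, ~ K q -> a q = u q) -> (forall q, ~ K q -> b q = v q) ->
  \int[leb2]_(q in K) planar_jacobian a b q = \int[leb2]_(q in K) planar_jacobian u v q.
Proof.
move=> Ca Cb Cu Cv cK au bv; have mK := compact_measurable_plane cK.
have iJ c d : class_C 1 c -> class_C 1 d -> leb2.-integrable K (EFin \o planar_jacobian c d).
  by move=> Cc Cd; exact/(continuous_compact_integrable_plane _ cK)/planar_jacobian_continuous.
apply/eqP; rewrite -subr_eq0 -(RintegralB mK (iJ _ _ Ca Cb) (iJ _ _ Cu Cv)).
have Cau := class_C1B Ca Cu; have Cbv := class_C1B Cb Cv.
apply/eqP; transitivity (\int[leb2]_(q in K) (planar_jacobian (fun q => a q - u q) b q
    - planar_jacobian (fun q => b q - v q) u q)).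
  apply: eq_Rintegral => q _.
  rewrite (planar_jacobianBl b q Ca Cu) (planar_jacobianBl u q Cb Cv).
  rewrite (planar_jacobianC b u) (planar_jacobianC v u).
  have alg (r s t : R) : r - t = r - s - (- s - - t) by ring.
  exact: alg.
rewrite (RintegralB mK (iJ _ _ Cau Cb) (iJ _ _ Cbv Cu)).
rewrite (Rintegral_planar_jacobian0 Cau Cb cK) => [|q Kq]; last by rewrite au ?subrr.
rewrite (Rintegral_planar_jacobian0 Cbv Cu cK) => [|q Kq]; last by rewrite bv ?subrr.
by rewrite subrr.
Qed.

(** The values of the two-forms i_X vol and i_Y vol on the coordinate tangent
    vectors of F, that is, the horizontal components of the normal before it is
    normalized. *)
Definition fluxX F q : R := (cross (tangent1 F q) (tangent2 F q)).1.1.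
Definition fluxY F q : R := (cross (tangent1 F q) (tangent2 F q)).1.2.
Definition horizontal_density F q : R := Num.sqrt (fluxX F q ^+ 2 + fluxY F q ^+ 2).

Lemma lagrange_identity (u w : frame_vec R) :
  dot u u * dot w w - dot u w ^+ 2 = dot (cross u w) (cross u w).
Proof.
by case: u w => [[u1 u2] u3] [[w1 w2] w3]; rewrite /dot /cross /=; ring.
Qed.

Lemma area_densityE F q : norm (Nh F q) * area_element F q = horizontal_density F q.
Proof.
rewrite /Nh /unit_normal /area_element /horizontal_density /fluxX /fluxY.
set u := tangent1 F q; set w := tangent2 F q.
rewrite lagrange_identity -/(norm _); move: (cross u w) => c.
have [n0|n0] := eqVneq (norm c) 0.
  rewrite n0 mulr0; move/eqP: n0; rewrite /norm sqrtr_eq0 /dot => n0.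
  suff -> : c.1.1 ^+ 2 + c.1.2 ^+ 2 = 0 by rewrite sqrtr0.
  by apply/eqP; rewrite eq_le; apply/andP; split; nra.
have scE (k r : R) : k *: r = k * r by [].
have np : 0 < norm c by rewrite lt0r n0 sqrtr_ge0.
rewrite -[X in _ * X = _](ger0_norm (ltW np)) -sqrtr_sqr -sqrtrM.
  congr Num.sqrt; rewrite /hproj /dot/= !scE.
  move: (norm c) n0 => n n0; field.
  exact: n0.
rewrite /dot/=; nra.
Qed.

Lemma derive_x F q d : differentiable F q ->
  ('D_d F q).1.1 = 'D_d (fun q => (F q).1.1) q.
Proof. by move=> dF; rewrite -!derive_fst//; exact: differentiable_fst. Qed.

Lemma derive_y F q d : differentiable F q ->
  ('D_d F q).1.2 = 'D_d (fun q => (F q).1.2) q.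
Proof.
by move=> dF; rewrite -derive_fst// -derive_snd//; exact: differentiable_fst.
Qed.

Lemma derive_z F q d : differentiable F q ->
  ('D_d F q).2 = 'D_d (fun q => (F q).2) q.
Proof. by move=> dF; rewrite -derive_snd. Qed.

Notation x F := (fun q => (F q).1.1).
Notation y F := (fun q => (F q).1.2).
Notation z F := (fun q => (F q).2).

Lemma class_C_x (V : normedModType R) k (F : V -> E11 R) :
  class_C k F -> class_C k (x F).
Proof. by move=> CF; exact: (class_C_fst (class_C_fst CF)). Qed.

Lemma class_C_y (V : normedModType R) k (F : V -> E11 R) :
  class_C k F -> class_C k (y F).
Proof. by move=> CF; exact: (class_C_snd (class_C_fst CF)). Qed.

Lemma class_C_z (V : normedModType R) k (F : V -> E11 R) :
  class_C k F -> class_C k (z F).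
Proof. by move=> CF; exact: (class_C_snd CF). Qed.

Lemma cross_frame_X (p v w : E11 R) :
  (cross (frame p v) (frame p w)).1.1 = v.1.2 * w.1.1 - w.1.2 * v.1.1.
Proof.
case: p v w => [p0 p3] [[v1 v2] v3] [[w1 w2] w3]; rewrite /cross /frame /=.
have e0 : expR p3 != 0 by rewrite gt_eqF// expR_gt0.
have s2 : Num.sqrt 2 * Num.sqrt 2 = 2 :> R by rewrite -expr2 sqr_sqrtr.
have divs (k l : R) : k / Num.sqrt 2 * (l / Num.sqrt 2) = k * l / 2.
  by rewrite mulrACA -invfM s2.
by rewrite !divs expRN; field.
Qed.

Lemma cross_frame_Y (p v w : E11 R) :
  (cross (frame p v) (frame p w)).1.2 =
  (expR (- p.2) * (v.1.1 * w.2 - w.1.1 * v.2) +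
   expR p.2 * (v.1.2 * w.2 - w.1.2 * v.2)) / Num.sqrt 2.
Proof.
by case: p v w => [p0 p3] [[v1 v2] v3] [[w1 w2] w3]; rewrite /cross /frame /=; ring.
Qed.

Lemma fluxXE F q : differentiable F q -> fluxX F q = planar_jacobian (y F) (x F) q.
Proof.
move=> dF; rewrite /fluxX cross_frame_X.
by congr (_ * _ - _ * _); first [exact: derive_x|exact: derive_y].
Qed.

Lemma fluxYE F q : differentiable F q -> fluxY F q =
  (expR (- (F q).2) * planar_jacobian (x F) (z F) q
   + expR (F q).2 * planar_jacobian (y F) (z F) q) / Num.sqrt 2.
Proof.
move=> dF; rewrite /fluxY cross_frame_Y.
congr ((_ * (_ * _ - _ * _) + _ * (_ * _ - _ * _)) / _);
  first [exact: derive_z|exact: derive_x|exact: derive_y].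
Qed.

(** This form of i_Y vol, unlike the one of [fluxYE], exhibits it as a
    combination with constant coefficients of forms da /\ dv, to which Stokes'
    theorem applies. *)
Lemma fluxY_planar_jacobian F q : class_C 1 F -> fluxY F q =
  (planar_jacobian (y F) (fun q => expR (F q).2) q
   - planar_jacobian (x F) (fun q => expR (- (F q).2)) q)
  / Num.sqrt 2.
Proof.
move=> CF; have [dF _] := CF.
have [dz _] := class_C_z CF; have [dNz _] := class_C1N (class_C_z CF).
have De d : 'D_d (fun q => expR (F q).2) q = expR (F q).2 * 'D_d (z F) q.
  exact: derive_expR_comp.
have De' d : 'D_d (fun q => expR (- (F q).2)) q = - (expR (- (F q).2) * 'D_d (z F) q).
  rewrite derive_expR_comp// -mulrN; congr (_ * _).
  by rewrite [LHS]deriveN//; exact: diff_derivable.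
rewrite fluxYE// /planar_jacobian (De (1, 0)) (De (0, 1)) (De' (1, 0)) (De' (0, 1)).
have alg (p n x1 x2 y1 y2 z1 z2 k : R) :
  (p * (x1 * z2 - x2 * z1) + n * (y1 * z2 - y2 * z1)) / k =
  (y1 * (n * z2) - y2 * (n * z1) - (x1 * - (p * z2) - x2 * - (p * z1))) / k by ring.
exact: alg.
Qed.

Lemma fluxX_fun F : class_C 1 F -> fluxX F = planar_jacobian (y F) (x F).
Proof. by move=> [dF _]; apply/funext => q; exact: fluxXE. Qed.

Lemma fluxY_fun F : class_C 1 F -> fluxY F = fun q =>
  (planar_jacobian (y F) (fun q => expR (F q).2) q
   - planar_jacobian (x F) (fun q => expR (- (F q).2)) q) / Num.sqrt 2.
Proof. by move=> CF; apply/funext => q; exact: fluxY_planar_jacobian. Qed.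

Lemma fluxX_continuous F : class_C 1 F -> continuous (fluxX F).
Proof.
move=> CF; rewrite fluxX_fun//.
exact: (planar_jacobian_continuous (class_C_y CF) (class_C_x CF)).
Qed.

Lemma fluxY_continuous F : class_C 1 F -> continuous (fluxY F).
Proof.
move=> CF; rewrite fluxY_fun//.
apply: continuous_mul; last exact: continuous_cst.
have CyF := class_C_y CF; have CxF := class_C_x CF; have CzF := class_C_z CF.
apply: continuous_sub.
  exact: (planar_jacobian_continuous CyF (class_C1_expR CzF)).
exact: (planar_jacobian_continuous CxF (class_C1_expR (class_C1N CzF))).
Qed.

Lemma Rintegral_fluxX F G K : class_C 1 F -> class_C 1 G -> compact K ->
  (forall q, ~ K q -> F q = G q) ->
  \int[leb2]_(q in K) fluxX F q = \int[leb2]_(q in K) fluxX G q.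
Proof.
move=> CF CG cK FG.
have E H : class_C 1 H -> \int[leb2]_(q in K) fluxX H q =
    \int[leb2]_(q in K) planar_jacobian (y H) (x H) q.
  by move=> CH; rewrite fluxX_fun.
apply: etrans (E F CF) (etrans _ (esym (E G CG))).
apply: (eq_Rintegral_planar_jacobian (class_C_y CF) (class_C_x CF)
                                     (class_C_y CG) (class_C_x CG) cK).
- by move=> q Kq; rewrite FG.
- by move=> q Kq; rewrite FG.
Qed.

Lemma Rintegral_fluxY F G K : class_C 1 F -> class_C 1 G -> compact K ->
  (forall q, ~ K q -> F q = G q) ->
  \int[leb2]_(q in K) fluxY F q = \int[leb2]_(q in K) fluxY G q.
Proof.
move=> CF CG cK FG; have mK := compact_measurable_plane cK.
have iJ a b : class_C 1 a -> class_C 1 b ->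
    leb2.-integrable K (EFin \o planar_jacobian a b).
  move=> Ca Cb; have cab := planar_jacobian_continuous Ca Cb.
  exact: (continuous_compact_integrable_plane cab cK).
have expand H : class_C 1 H -> \int[leb2]_(q in K) fluxY H q =
    (\int[leb2]_(q in K) planar_jacobian (y H) (fun q => expR (H q).2) q
     - \int[leb2]_(q in K) planar_jacobian (x H) (fun q => expR (- (H q).2)) q)
    / Num.sqrt 2.
  move=> CH; rewrite fluxY_fun//.
  have CyH := class_C_y CH; have CxH := class_C_x CH; have CzH := class_C_z CH.
  have Ce := class_C1_expR CzH; have Ce' := class_C1_expR (class_C1N CzH).
  rewrite -(RintegralB mK (iJ _ _ CyH Ce) (iJ _ _ CxH Ce')).
  apply: RintegralZr => //; apply: (continuous_compact_integrable_plane _ cK).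
  exact: (continuous_sub (planar_jacobian_continuous CyH Ce)
                         (planar_jacobian_continuous CxH Ce')).
apply: etrans (expand F CF) (etrans _ (esym (expand G CG))).
have CzF := class_C_z CF; have CzG := class_C_z CG.
apply: (congr2 (fun r s => (r - s) / Num.sqrt 2)).
  apply: (eq_Rintegral_planar_jacobian (class_C_y CF) (class_C1_expR CzF)
    (class_C_y CG) (class_C1_expR CzG) cK).
  - by move=> q Kq; rewrite FG.
  - by move=> q Kq; rewrite FG.
apply: (eq_Rintegral_planar_jacobian (class_C_x CF) (class_C1_expR (class_C1N CzF))
  (class_C_x CG) (class_C1_expR (class_C1N CzG)) cK).
- by move=> q Kq; rewrite FG.
- by move=> q Kq; rewrite FG.
Qed.

End Flux.

(** * Elementary inequalities for calibrations *)

Section Elementary.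
Variable R : realType.

Lemma calibration_le (e1 e2 p r : R) : e1 ^+ 2 + e2 ^+ 2 = 1 ->
  e1 * p + e2 * r <= Num.sqrt (p ^+ 2 + r ^+ 2).
Proof.
move=> e12; rewrite (le_trans (ler_norm _))// -sqrtr_sqr ler_wsqrtr//.
have -> : p ^+ 2 + r ^+ 2 = (e1 ^+ 2 + e2 ^+ 2) * (p ^+ 2 + r ^+ 2) by rewrite e12 mul1r.
have := sqr_ge0 (e1 * r - e2 * p); nra.
Qed.

Lemma calibration_eq (e1 e2 s : R) : e1 ^+ 2 + e2 ^+ 2 = 1 -> 0 <= s ->
  Num.sqrt ((s * e1) ^+ 2 + (s * e2) ^+ 2) = s.
Proof. by move=> e12 s0; rewrite !exprMn -mulrDr e12 mulr1 sqrtr_sqr ger0_norm. Qed.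

(** If A is the component of (p, r) along e and B the orthogonal one, then
    sqrt (A^2 + B^2) - A <= B^2 / (2 A). Here |B| <= 2 d because the vector s e
    has no orthogonal component, and A >= m - 2 d >= m / 2. *)
Lemma calibration_excess (e1 e2 s m p r d : R) : e1 ^+ 2 + e2 ^+ 2 = 1 ->
  0 < m -> m <= s -> 4 * d <= m -> `|p - s * e1| <= d -> `|r - s * e2| <= d ->
  Num.sqrt (p ^+ 2 + r ^+ 2) - (e1 * p + e2 * r) <= 4 * d ^+ 2 / m.
Proof.
move=> e12 m0 ms dm; rewrite !ler_norml => /andP[p1 p2] /andP[r1 r2].
have d0 : 0 <= d by lra.
set A := e1 * p + e2 * r; set B := e1 * r - e2 * p.
have pr : p ^+ 2 + r ^+ 2 = A ^+ 2 + B ^+ 2.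
  transitivity ((e1 ^+ 2 + e2 ^+ 2) * (p ^+ 2 + r ^+ 2)); first by rewrite e12 mul1r.
  by rewrite /A /B; ring.
have e1b : -1 <= e1 <= 1 by apply/andP; split; nra.
have e2b : -1 <= e2 <= 1 by apply/andP; split; nra.
move: e1b e2b => /andP[e1a e1b] /andP[e2a e2b].
have AE : A = s + (e1 * (p - s * e1) + e2 * (r - s * e2)).
  by rewrite -[X in X + _](mulr1 s) -e12 /A; ring.
have BE : B = e1 * (r - s * e2) - e2 * (p - s * e1) by rewrite /B; ring.
have bnd (x y : R) : -1 <= x -> x <= 1 -> - d <= y -> y <= d -> - d <= x * y <= d.
  by move=> *; apply/andP; split; nra.
have /andP[a1 a2] := bnd _ _ e1a e1b p1 p2.
have /andP[a3 a4] := bnd _ _ e2a e2b r1 r2.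
have /andP[b1 b2] := bnd _ _ e1a e1b r1 r2.
have /andP[b3 b4] := bnd _ _ e2a e2b p1 p2.
have Am : m / 2 <= A by lra.
have B2 : B ^+ 2 <= 4 * d ^+ 2.
  have Ba : - (2 * d) <= B by lra.
  have Bb : B <= 2 * d by lra.
  nra.
have A0 : 0 < A by lra.
have q0 : 0 <= 4 * d ^+ 2 / m.
  by rewrite divr_ge0 ?(ltW m0)// mulr_ge0// sqr_ge0.
have Aq0 : 0 <= A + 4 * d ^+ 2 / m by rewrite addr_ge0 ?(ltW A0).
rewrite lerBlDl pr -(ger0_norm Aq0) -sqrtr_sqr ler_wsqrtr//.
have qm : 4 * d ^+ 2 / m * m = 4 * d ^+ 2 by rewrite divfK// gt_eqF.
move: (4 * d ^+ 2 / m) q0 qm {Aq0} => u q0 qm.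
have Au : B ^+ 2 <= 2 * A * u by nra.
nra.
Qed.

Lemma is_derive0_quadratic (A : R -> R) (C r : R) : 0 < r ->
  (forall t, `|t| < r -> `|A t - A 0| <= C * t ^+ 2) -> is_derive (0 : R) 1 A 0.
Proof.
move=> r0 AC.
suff H : (fun h : R => h^-1 *: (A (h *: (1 : R) + 0) - A 0)) @ (0 : R)^' --> (0 : R).
  apply: DeriveDef; first by apply/cvg_ex; exists 0.
  exact: cvg_lim.
apply/cvgrPdist_le => e e0.
pose s := Num.min r (e / (`|C| + 1)).
have C1 : 0 < `|C| + 1 by rewrite ltr_pwDr.
have s0 : 0 < s by rewrite lt_min r0 divr_gt0.
exists s => //= h /=; rewrite [X in X < s]distrC subr0 => hs h0.
have hr : `|h| < r by rewrite (lt_le_trans hs)// /s ge_min lexx.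
have he : `|h| < e / (`|C| + 1) by rewrite (lt_le_trans hs)// /s ge_min lexx orbT.
rewrite sub0r normrN addr0 [h *: 1]mulr1 normrZ normfV.
rewrite ler_pdivrMl ?normr_gt0//; apply: le_trans (AC _ hr) _.
rewrite -real_normK ?num_real//.
have hC : `|h| * (`|C| + 1) <= e by rewrite -ler_pdivlMr// ltW.
have := ler_norm C; have := normr_ge0 h; nra.
Qed.

End Elementary.

(** * Calibrated surfaces minimize the area *)

Section Calibration.
Variable R : realType.
Notation leb2 := ((@lebesgue_measure R) \x (@lebesgue_measure R))%E.
Implicit Types (F f : R * R -> E11 R) (K : set (R * R)).

Lemma horizontal_density_continuous F : class_C 1 F -> continuous (horizontal_density F).
Proof.
move=> CF; have c1 := fluxX_continuous CF; have c2 := fluxY_continuous CF.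
rewrite (_ : horizontal_density F = fun q =>
    Num.sqrt (fluxX F q * fluxX F q + fluxY F q * fluxY F q)); last first.
  by apply/funext => q; rewrite /horizontal_density !expr2.
move=> q; apply: (@continuous_comp _ _ _
    (fun q => fluxX F q * fluxX F q + fluxY F q * fluxY F q)).
  exact: (continuous_add (continuous_mul c1 c1) (continuous_mul c2 c2)).
exact: sqrt_continuous.
Qed.

Lemma sr_areaE F K : class_C 1 F -> compact K ->
  sr_area F K = (\int[leb2]_(q in K) horizontal_density F q)%:E.
Proof.
move=> CF cK; rewrite /sr_area /Rintegral fineK.
  by apply: eq_integral => q _; rewrite area_densityE.
apply: integrable_fin_num; first exact: compact_measurable_plane.
exact: (continuous_compact_integrable_plane (horizontal_density_continuous CF) cK).
Qed.

Variables (e1 e2 : R).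
Hypothesis e12 : e1 ^+ 2 + e2 ^+ 2 = 1.

(** The form i_V vol along F, for V = e1 X + e2 Y. *)
Definition flux F q : R := e1 * fluxX F q + e2 * fluxY F q.

(** The horizontal normal of f is the unit vector e = (e1, e2) everywhere;
    positivity of the flux also excludes singular points. *)
Definition calibrated f : Prop := forall q,
  [/\ 0 < flux f q, fluxX f q = flux f q * e1 & fluxY f q = flux f q * e2].

Lemma flux_continuous F : class_C 1 F -> continuous (flux F).
Proof.
move=> CF; have c1 := fluxX_continuous CF; have c2 := fluxY_continuous CF.
apply: continuous_add.
  exact: (continuous_mul (@continuous_cst _ _ e1) c1).
exact: (continuous_mul (@continuous_cst _ _ e2) c2).
Qed.

Lemma Rintegral_flux F f K : class_C 1 F -> class_C 1 f -> compact K ->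
  (forall q, ~ K q -> F q = f q) ->
  \int[leb2]_(q in K) flux F q = \int[leb2]_(q in K) flux f q.
Proof.
move=> CF Cf cK Ff; have mK := compact_measurable_plane cK.
have expand G : class_C 1 G -> \int[leb2]_(q in K) flux G q =
    e1 * \int[leb2]_(q in K) fluxX G q + e2 * \int[leb2]_(q in K) fluxY G q.
  move=> CG; have c1 := fluxX_continuous CG; have c2 := fluxY_continuous CG.
  have i1 := continuous_compact_integrable_plane c1 cK.
  have i2 := continuous_compact_integrable_plane c2 cK.
  have ic (k : R) g : continuous g -> leb2.-integrable K (EFin \o (fun q => k * g q)).
    move=> cg; have ckg := continuous_mul (@continuous_cst _ _ k) cg.
    exact: (continuous_compact_integrable_plane ckg cK).
  rewrite -(RintegralZl e1 mK i1) -(RintegralZl e2 mK i2).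
  exact: (RintegralD mK (ic e1 _ c1) (ic e2 _ c2)).
apply: etrans (expand F CF) (etrans _ (esym (expand f Cf))).
apply: (congr2 (fun r s => e1 * r + e2 * s)).
  exact: Rintegral_fluxX.
exact: Rintegral_fluxY.
Qed.

Lemma calibrated_horizontal_density f q : calibrated f -> horizontal_density f q = flux f q.
Proof.
move=> /(_ q)[s0 f1 f2]; rewrite /horizontal_density f1 f2.
exact: (calibration_eq e12 (ltW s0)).
Qed.

Lemma flux_le_horizontal_density F q : flux F q <= horizontal_density F q.
Proof. exact: calibration_le. Qed.

Lemma calibrated_Rintegral F f K : class_C 1 F -> class_C 1 f -> compact K ->
  calibrated f -> (forall q, ~ K q -> F q = f q) ->
  \int[leb2]_(q in K) horizontal_density f q = \int[leb2]_(q in K) flux F q.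
Proof.
move=> CF Cf cK calf Ff; rewrite (Rintegral_flux CF Cf cK Ff).
by apply: eq_Rintegral => q _; exact: calibrated_horizontal_density.
Qed.

Lemma calibrated_minimizing f F K : class_C 1 F -> class_C 1 f -> compact K ->
  calibrated f -> (forall q, ~ K q -> F q = f q) ->
  \int[leb2]_(q in K) horizontal_density f q <= \int[leb2]_(q in K) horizontal_density F q.
Proof.
move=> CF Cf cK calf Ff.
have le_of_eq (r s : R) : r = s -> r <= s by move=> ->.
apply: le_trans (le_of_eq _ _ (calibrated_Rintegral CF Cf cK calf Ff)) _.
apply: le_Rintegral.
- exact: compact_measurable_plane.
- exact: (continuous_compact_integrable_plane (flux_continuous CF) cK).
- exact: (continuous_compact_integrable_plane (horizontal_density_continuous CF) cK).
- by move=> q _; exact: flux_le_horizontal_density.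
Qed.

Lemma calibrated_lower_bound f K : class_C 1 f -> compact K -> calibrated f ->
  exists2 m : R, 0 < m & forall q, K q -> m <= flux f q.
Proof.
move=> Cf cK calf; have [K0|/set0P/negP/negPn/eqP ->] := pselect (K !=set0); last first.
  by exists 1.
have [q _ qmin] := compact_EVT_min K0 cK (continuous_subspaceT (flux_continuous Cf)).
exists (flux f q); first by have [] := calf q.
by move=> p Kp; apply: qmin; rewrite inE.
Qed.

End Calibration.

(** * Calibrated surfaces are area-stationary *)

Section Variation.
Variable R : realType.
Notation leb2 := ((@lebesgue_measure R) \x (@lebesgue_measure R))%E.

Lemma derive_slice (V W U : normedModType R) (F : V * W -> U) (t : V) (d q : W) :
  'D_d (fun q => F (t, q)) q = 'D_(0, d) F (t, q).
Proof.
rewrite /derive; do 2 f_equal; apply/funext => h /=.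
by congr (_ *: (F _ - _)); congr pair; rewrite /= scaler0 add0r.
Qed.

Lemma class_C1_Lipschitz (V : normedModType R) (W : R * V -> R) (K : set V) :
  class_C 1 W -> compact K ->
  exists2 L, 0 < L & forall t q, `|t| <= 1 -> K q -> `|W (t, q) - W (0, q)| <= L * `|t|.
Proof.
move=> [dW cW] cK.
have cI := compact_setX (@segment_compact R (-1) 1) cK.
have /compact_bounded[L0 [_ L0W]] := continuous_compact (continuous_subspaceT (cW (1, 0))) cI.
exists (`|L0| + 1) => [|t q t1 Kq]; first by rewrite ltr_pwDr.
have line (s : R) : (s, q) = s *: (1, 0) + (0, q).
  by congr pair => /=; [rewrite [_ *: _]mulr1 addr0|rewrite scaler0 add0r].
have DW (s : R) : is_derive s 1 (fun s : R => W (s, q)) ('D_(1, 0) W (s, q)).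
  rewrite (_ : (fun s : R => W (s, q)) = fun s => W (s *: (1, 0) + (0, q))).
    by rewrite (line s); exact: is_derive_line.
  by apply/funext => r; rewrite line.
have [c ct] := MVT_increment 0 t DW; rewrite !addr0 => ->.
rewrite normrM mulrC ler_wpM2r//.
apply: (L0W (`|L0| + 1)); first by rewrite ltr_pwDr// ler_norm.
exists (c, q) => //; split => //=.
by rewrite in_itv/= -ler_norml (le_trans ct).
Qed.

(** The flux involves one derivative in q of a variation which is jointly of
    class C^2, so it is jointly of class C^1 in (t, q), hence Lipschitz in t. *)
Lemma class_C1_flux_variation (phi : R -> R * R -> E11 R) :
  class_C 2 (fun tq : R * (R * R) => phi tq.1 tq.2) ->
  class_C 1 (fun tq : R * (R * R) => fluxX (phi tq.1) tq.2) /\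
  class_C 1 (fun tq : R * (R * R) => fluxY (phi tq.1) tq.2).
Proof.
move=> C2.
have Cjac (a b : R * (R * R) -> R) : class_C 2 a -> class_C 2 b ->
    class_C 1 (fun tq => planar_jacobian (fun q => a (tq.1, q)) (fun q => b (tq.1, q)) tq.2).
  move=> [_ Ca] [_ Cb]; rewrite (_ : (fun tq => _) = fun tq =>
    'D_(0, (1, 0)) a tq * 'D_(0, (0, 1)) b tq + - ('D_(0, (0, 1)) a tq * 'D_(0, (1, 0)) b tq)).
    apply: class_C1D; last apply: class_C1N; apply: class_C1M;
      [exact: Ca|exact: Cb|exact: Ca|exact: Cb].
  apply/funext => -[t q]; rewrite /planar_jacobian.
  have S (c : R * (R * R) -> R) d : 'D_d (fun q => c (t, q)) q = 'D_(0, d) c (t, q).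
    exact: derive_slice.
  apply: (congr2 (fun r s : R => r - s)); apply: (congr2 (fun r s : R => r * s)).
  - exact: (S a (1, 0)).
  - exact: (S b (0, 1)).
  - exact: (S a (0, 1)).
  - exact: (S b (1, 0)).
have dphi t q : differentiable (phi t) q.
  have [dPhi _] := C2.
  apply: (differentiable_comp (f := fun q => (t, q)) (g := fun tq => phi tq.1 tq.2)).
    exact: differentiable_pair.
  exact: dPhi.
have Cx := class_C_x C2; have Cy := class_C_y C2; have Cz := class_C_z C2.
have C1z : class_C 1 (fun tq : R * (R * R) => (phi tq.1 tq.2).2).
  exact: class_C2_C1.
split.
  rewrite (_ : (fun tq => _) = fun tq : R * (R * R) =>
    planar_jacobian (fun q => (phi tq.1 q).1.2) (fun q => (phi tq.1 q).1.1) tq.2).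
    exact: (Cjac _ _ Cy Cx).
  by apply/funext => -[t q]; exact: fluxXE.
rewrite (_ : (fun tq => _) = fun tq : R * (R * R) =>
   (expR (- (phi tq.1 tq.2).2)
      * planar_jacobian (fun q => (phi tq.1 q).1.1) (fun q => (phi tq.1 q).2) tq.2
   + expR (phi tq.1 tq.2).2
      * planar_jacobian (fun q => (phi tq.1 q).1.2) (fun q => (phi tq.1 q).2) tq.2)
   * (Num.sqrt 2)^-1).
  apply: class_C1M; last exact: class_C_cst.
  apply: class_C1D; apply: class_C1M.
  - exact/class_C1_expR/class_C1N.
  - exact: (Cjac _ _ Cx Cz).
  - exact: class_C1_expR.
  - exact: (Cjac _ _ Cy Cz).
by apply/funext => -[t q]; exact: fluxYE.
Qed.

(** The area of f equals the flux of e through every phi_t, so A(t) - A(0) is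
    the integral over K of the pointwise excess of length over flux; this excess
    is of order t^2 by [calibration_excess]. *)
Lemma calibrated_stationary (e1 e2 : R) (f : R * R -> E11 R) K phi :
  e1 ^+ 2 + e2 ^+ 2 = 1 -> class_C 1 f -> calibrated e1 e2 f -> compact K ->
  Defs.variation f K phi -> is_derive (0 : R) 1 (fun t => fine (sr_area (phi t) K)) 0.
Proof.
move=> e12 Cf calf cK [C2 phi0 dphi]; have mK := compact_measurable_plane cK.
have Cphi t : class_C 1 (phi t) by have [] := dphi t.
have phif t q : ~ K q -> phi t q = f q by have [_ _] := dphi t; exact.
have AE : (fun t => fine (sr_area (phi t) K)) =
    fun t => \int[leb2]_(q in K) horizontal_density (phi t) q.
  by apply/funext => t; rewrite (sr_areaE (Cphi t) cK).
rewrite AE.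
have [m m0 fm] := calibrated_lower_bound Cf cK calf.
have [C1 D2] := class_C1_flux_variation C2.
have [L1 L10 lip1] := class_C1_Lipschitz C1 cK.
have [L2 L20 lip2] := class_C1_Lipschitz D2 cK.
pose L := L1 + L2; have L0 : 0 < L by rewrite addr_gt0.
have mL : 0 < m / (4 * L) by rewrite divr_gt0// mulr_gt0.
apply: (@is_derive0_quadratic _ _ (4 * L ^+ 2 / m * fine (leb2 K)) (Num.min 1 (m / (4 * L)))).
  by rewrite lt_min ltr01 mL.
move=> t; rewrite lt_min => /andP[/ltW t1 tm].
have i1 := continuous_compact_integrable_plane (horizontal_density_continuous (Cphi t)) cK.
have i2 := continuous_compact_integrable_plane (flux_continuous (e1 := e1) (e2 := e2) (Cphi t)) cK.
have diffE : \int[leb2]_(q in K) horizontal_density (phi t) q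
    - \int[leb2]_(q in K) horizontal_density (phi 0) q
  = \int[leb2]_(q in K) (horizontal_density (phi t) q - flux e1 e2 (phi t) q).
  rewrite (RintegralB mK i1 i2) phi0; apply: (congr1 (fun r : R => _ - r)).
  exact: (calibrated_Rintegral e12 (Cphi t) Cf cK calf (phif t)).
rewrite diffE ger0_norm; last first.
  by apply: Rintegral_ge0 => q _; rewrite subr_ge0; exact: flux_le_horizontal_density.
have -> : 4 * L ^+ 2 / m * fine (leb2 K) * t ^+ 2
    = \int[leb2]_(q in K) (4 * (L * `|t|) ^+ 2 / m).
  rewrite Rintegral_cst// exprMn real_normK ?num_real//.
  by move: (fine _) => ?; ring.
apply: le_Rintegral => //.
- have cdiff := continuous_sub (horizontal_density_continuous (Cphi t))
    (flux_continuous (e1 := e1) (e2 := e2) (Cphi t)).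
  exact: (continuous_compact_integrable_plane cdiff cK).
- exact: (continuous_compact_integrable_plane (@continuous_cst _ _ _) cK).
move=> q Kq; have [s0 f1 f2] := calf q.
apply: (calibration_excess e12 m0 (fm q Kq)).
- rewrite mulrA -ler_pdivlMl ?mulr_gt0// mulrC; exact: ltW.
- rewrite -f1 -phi0; apply: le_trans (lip1 t q t1 Kq) _.
  by rewrite ler_wpM2r// lerDl ltW.
- rewrite -f2 -phi0; apply: le_trans (lip2 t q t1 Kq) _.
  by rewrite ler_wpM2r// lerDr ltW.
Qed.

End Variation.

(** * The foliation of a calibrated surface *)

Lemma cross_horizontal (R : realType) (u w : frame_vec R) :
  u.2 = 0 -> w.2 = 0 -> (cross u w).1.1 = 0 /\ (cross u w).1.2 = 0.
Proof. by rewrite /cross /= => -> ->; rewrite !mulr0 !mul0r subrr. Qed.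

Section CalibratedFoliation.
Variables (R : realType) (e1 e2 : R) (f : R * R -> E11 R).
Hypotheses (e12 : e1 ^+ 2 + e2 ^+ 2 = 1) (e1e2 : e1 * e2 = 0).
Hypotheses (Cf : class_C 1 f) (calf : calibrated e1 e2 f).

Lemma calibrated_nonsingular q : ~ singular f q.
Proof.
have [df _] := Cf.
move=> sing; have [+ _ _] := calf q; apply/negP; rewrite -leNgt.
have T0 d : (frame (f q) ('D_d f q)).2 = 0.
  have : [set u : frame_vec R | horizontal u] (frame (f q) ('D_d f q)).
    by rewrite -sing deriveE//; exists ('d f q d) => //; exists d.
  by [].
have [c1 c2] := cross_horizontal (T0 (1, 0)) (T0 (0, 1)).
rewrite le_eqVlt; apply/orP; left; apply/eqP.
have alg (p r : R) : p = 0 -> r = 0 -> e1 * p + e2 * r = 0.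
  by move=> -> ->; rewrite !mulr0 addr0.
exact: alg c1 c2.
Qed.

Lemma calibrated_Z q : Z f q = (- e2, e1, 0).
Proof.
have [s0 f1 f2] := calf q.
rewrite /Z /nu_h /Nh /unit_normal.
have c1 : (cross (tangent1 f q) (tangent2 f q)).1.1 = flux e1 e2 f q * e1 by rewrite -f1.
have c2 : (cross (tangent1 f q) (tangent2 f q)).1.2 = flux e1 e2 f q * e2 by rewrite -f2.
move: (flux _ _ _ _) s0 c1 c2 => s s0 {f1 f2}.
move: (cross _ _) => [[p r] w] /= -> ->.
have n0 : 0 < norm (s * e1, s * e2, w).
  rewrite /norm /dot /= sqrtr_gt0.
  have -> : s * e1 * (s * e1) + s * e2 * (s * e2) + w * w
    = s ^+ 2 * (e1 ^+ 2 + e2 ^+ 2) + w ^+ 2 by ring.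
  by rewrite e12 mulr1 ltr_pwDl ?exprn_gt0// sqr_ge0.
move: (norm _) n0 => n n0.
rewrite /hproj /=.
have scE (k r' : R) : k *: r' = k * r' by [].
have k0 : 0 <= n^-1 * s by rewrite mulr_ge0 ?invr_ge0 ?ltW.
have -> : norm (n^-1 *: (s * e1), n^-1 *: (s * e2), 0) = n^-1 * s.
  rewrite /norm /dot/= !scE mulr0 addr0.
  rewrite -[RHS](calibration_eq e12 k0); congr Num.sqrt; ring.
rewrite /J/= !scE; congr (_, _, _).
  by congr (- _); field; rewrite !gt_eqF.
by field; rewrite !gt_eqF.
Qed.

(** On I the components of the velocity are the constants (- e2, e1, 0). Their
    derivative vanishes, and so does the connection term, as it is proportional
    to the T-component of the velocity. The torsion term is e1 e2. *)
Lemma calibrated_geodesic I g : integral_curve_Z f I g -> sr_geodesic I g.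
Proof.
move=> [oI _ Ig].
have V t : I t -> velocity g t = (- e2, e1, 0).
  by move=> /Ig[_ [q [_ _ ->]]]; exact: calibrated_Z.
have nearV t : I t -> \near t, cst (- e2, e1, 0) t = velocity g t.
  by move=> It; apply: filterS (open_nbhs_nbhs (conj oI It)) => s /V.
split=> t It; last by rewrite V// /dot /tau/=; move: e1e2; nra.
split.
- by have [] := Ig t It.
- by apply: near_eq_derivable (nearV t It) _; exact: derivable_cst.
- by rewrite V// /norm /dot/= -[RHS]sqrtr1 -e12; congr Num.sqrt; ring.
- by rewrite V.
- rewrite /covariant_derivative -(near_eq_derive _ (nearV t It)) derive_cst.
  by rewrite V// /connection/= scale0r scale0r !addr0.
Qed.

(** The components of w depend on the base point through z alone. Since
    e1 e2 = 0, either w is a multiple of X, which has the same components at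
    every point, or w is a multiple of Y and z is constant along the line. *)
Lemma frame_flow (p : E11 R) (t : R) :
  let w := - e2 *: fieldX p + e1 *: fieldY p in
  frame (t *: w + p) w = (- e2, e1, 0).
Proof.
have s2 : Num.sqrt 2 * Num.sqrt 2 = 2 :> R by rewrite -expr2 sqr_sqrtr.
have divs (k l : R) : k / Num.sqrt 2 * (l / Num.sqrt 2) = k * l / 2.
  by rewrite mulrACA -invfM s2.
have scE (k r : R) : k *: r = k * r by [].
case: p => [[x y] z]; rewrite /frame /fieldX /fieldY /= !scE.
have ez : expR z != 0 by rewrite gt_eqF// expR_gt0.
move/eqP: e1e2; rewrite mulf_eq0 => /orP[/eqP ->|/eqP ->].
  by rewrite !(mulr0, mul0r, mulr1, addr0).
rewrite oppr0 !(mulr0, mul0r, mulr1, add0r, addr0).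
have r2 : Num.sqrt 2 != 0 :> R by rewrite gt_eqF// sqrtr_gt0.
congr (_, _, _); last by ring.
rewrite expRN; transitivity (e1 * 2 / (Num.sqrt 2 * Num.sqrt 2)).
  by field; rewrite r2 ez.
by rewrite s2 mulfK.
Qed.

Lemma calibrated_integral_curve (S : set (E11 R)) q : range f = S ->
  (forall p t, S p -> S (t *: (- e2 *: fieldX p + e1 *: fieldY p) + p)) ->
  integral_curve_Z f setT
    (fun t : R => t *: (- e2 *: fieldX (f q) + e1 *: fieldY (f q)) + f q).
Proof.
move=> fS Sflow; set w := (_ *: _ + _ *: _).
have Dg (t : R) : is_derive t 1 (fun t : R => t *: w + f q) w.
  have did : differentiable (@id (E11 R)) (t *: w + f q) by exact: ex_diff.
  have := is_derive_line did.
  by rewrite derive_id.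
split; [exact: openT|by []|move=> t _; split; first by have [] := Dg t].
have : S (t *: w + f q) by apply: Sflow; rewrite -fS; exists q.
rewrite -fS => -[q' _ fq']; exists q'; split => //.
  exact: calibrated_nonsingular.
rewrite calibrated_Z /velocity derive_val.
rewrite /w; exact: frame_flow.
Qed.

End CalibratedFoliation.

(** * The coordinate planes are calibrated *)

Section Sign.
Variable R : realType.

(** The intermediate value theorem along the segment joining two points. *)
Lemma constant_sign (g : R * R -> R) : continuous g -> (forall q, g q != 0) ->
  exists2 s : R, s ^+ 2 = 1 & forall q, 0 < s * g q.
Proof.
move=> cg g0.
have same_sign p q : 0 < g p -> 0 < g q.
  move=> gp; rewrite lt_neqAle eq_sym g0 leNgt; apply/negP => gq.
  pose l (t : R) := t *: (q - p) + p.
  have cl : continuous (fun t : R => g (l t)).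
    move=> t; apply: (@continuous_comp _ _ _ l g); last exact: cg.
    by apply: cvgD; [apply: cvgZr_tmp; exact: cvg_id|exact: cvg_cst].
  have gl0 : g (l 0) = g p by rewrite /l scale0r add0r.
  have gl1 : g (l 1) = g q by rewrite /l scale1r subrK.
  have [|t _ gt] := @IVT R (fun t => g (l t)) 0 1 0 ler01 (continuous_subspaceT cl).
    by rewrite gl0 gl1 ge_min le_max (ltW gp) (ltW gq) orbT.
  by move: (g0 (l t)); rewrite gt eqxx.
have [g00|g00] := ltP 0 (g (0, 0)).
  by exists 1; rewrite ?expr1n// => q; rewrite mul1r; exact: same_sign g00.
exists (-1); rewrite ?sqrrN ?expr1n// => q.
rewrite mulN1r oppr_gt0 lt_neqAle g0 leNgt; apply/negP => gq.
by have := same_sign q (0, 0) gq; rewrite ltNge g00.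
Qed.

End Sign.

Section Planes.
Variable R : realType.
Implicit Types (f : R * R -> E11 R) (S : set (E11 R)).

Lemma immersion_left_inverse f (h : E11 R -> R * R) :
  (forall q, differentiable f q) -> (forall p, differentiable h p) ->
  cancel f h -> immersion f.
Proof.
move=> df dh fK q; apply: (@can_inj _ _ _ ('d h (f q))) => v.
rewrite -[LHS]/(('d h (f q) \o 'd f q) v) -diff_comp//.
by rewrite (_ : h \o f = id) ?diff_val//; apply/funext => p; exact: fK.
Qed.

Lemma parametrizes_left_inverse f (h : E11 R -> R * R) S :
  class_C 2 f -> class_C 1 h -> cancel f h -> range f = S -> parametrizes f S.
Proof.
move=> Cf Ch fK fS; have [df _] := Cf; have [dh _] := Ch.
split => //; first exact: immersion_left_inverse fK.
by exists h => //; exact/continuous_subspaceT/class_C1_continuous.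
Qed.

Lemma plane_surface_x (c : R) : plane_surface [set p : E11 R | p.1.1 + c = 0].
Proof.
exists (fun q => ((- c, q.1), q.2)).
apply: (@parametrizes_left_inverse _ (fun p => (p.1.2, p.2))).
- apply: class_C_pair; last exact/class_C_snd/class_C_id.
  by apply: class_C_pair; [exact: class_C_cst|exact/class_C_fst/class_C_id].
- apply: class_C_pair; last exact/class_C_snd/class_C_id.
  exact/class_C_snd/class_C_fst/class_C_id.
- by case.
- apply/seteqP; split=> [_ [q _ <-]|[[x y] z]] /=; first by rewrite addNr.
  by move=> /eqP; rewrite addr_eq0 => /eqP ->; exists (y, z).
Qed.

Lemma plane_surface_y (c : R) : plane_surface [set p : E11 R | p.1.2 + c = 0].
Proof.
exists (fun q => ((q.1, - c), q.2)).
apply: (@parametrizes_left_inverse _ (fun p => (p.1.1, p.2))).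
- apply: class_C_pair; last exact/class_C_snd/class_C_id.
  by apply: class_C_pair; [exact/class_C_fst/class_C_id|exact: class_C_cst].
- apply: class_C_pair; last exact/class_C_snd/class_C_id.
  exact/class_C_fst/class_C_fst/class_C_id.
- by case.
- apply/seteqP; split=> [_ [q _ <-]|[[x y] z]] /=; first by rewrite addNr.
  by move=> /eqP; rewrite addr_eq0 => /eqP ->; exists (x, z).
Qed.

Lemma plane_surface_z (c : R) : plane_surface [set p : E11 R | p.2 + c = 0].
Proof.
exists (fun q => ((q.1, q.2), - c)).
apply: (@parametrizes_left_inverse _ (fun p => (p.1.1, p.1.2))).
- apply: class_C_pair; last exact: class_C_cst.
  by apply: class_C_pair; [exact/class_C_fst/class_C_id|exact/class_C_snd/class_C_id].
- apply: class_C_pair; last exact/class_C_snd/class_C_fst/class_C_id.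
  exact/class_C_fst/class_C_fst/class_C_id.
- by case.
- apply/seteqP; split=> [_ [q _ <-]|[[x y] z]] /=; first by rewrite addNr.
  by move=> /eqP; rewrite addr_eq0 => /eqP ->; exists (x, y).
Qed.

Lemma immersion_independent f q (r s : R) : class_C 1 f -> immersion f ->
  r *: 'D_(1, 0) f q + s *: 'D_(0, 1) f q = 0 -> r = 0 /\ s = 0.
Proof.
move=> [df _] inj rs.
have : 'd f q (r, s) = 'd f q 0.
  rewrite linear0 -rs !deriveE// -!linearZ -linearD; congr ('d f q _).
  by congr pair => /=; rewrite scaler0 [_ *: 1]mulr1 ?addr0 ?add0r.
by move/inj => [-> ->].
Qed.

Notation x f := (fun q => (f q).1.1).
Notation y f := (fun q => (f q).1.2).
Notation z f := (fun q => (f q).2).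

(** If all minors vanish, then w_i v - v_i w = 0 for each coordinate i, so by
    independence all coordinates of v and w are zero. *)
Lemma independent_minors (v w : E11 R) :
  (forall r s : R, r *: v + s *: w = 0 -> r = 0 /\ s = 0) ->
  v.1.1 * w.2 - w.1.1 * v.2 = 0 -> v.1.2 * w.2 - w.1.2 * v.2 = 0 ->
  v.1.2 * w.1.1 - w.1.2 * v.1.1 != 0.
Proof.
case: v w => [[v1 v2] v3] [[w1 w2] w3] /= ind m13 m23; apply/eqP => m12.
have scE (k r : R) : k *: r = k * r by [].
have pairE (r s : R) : r *: ((v1, v2), v3) + s *: ((w1, w2), w3)
    = ((r * v1 + s * w1, r * v2 + s * w2), r * v3 + s * w3) by [].
have zero (a b d : R) : a = 0 -> b = 0 -> d = 0 -> ((a, b), d) = 0 :> E11 R.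
  by move=> -> -> ->.
have [w10 _] : w1 = 0 /\ - v1 = 0.
  by apply: ind; rewrite pairE; apply: zero; lra.
have [w20 _] : w2 = 0 /\ - v2 = 0.
  by apply: ind; rewrite pairE; apply: zero; lra.
have [w30 _] : w3 = 0 /\ - v3 = 0.
  by apply: ind; rewrite pairE; apply: zero; lra.
have [_ /eqP] : 0 = 0 :> R /\ 1 = 0 :> R.
  by apply: ind; rewrite pairE w10 w20 w30; apply: zero; ring.
by rewrite oner_eq0.
Qed.

(** The Jacobians of the pairs of coordinates are the minors of the
    differential, whose columns are independent. *)
Lemma immersion_jacobian f q : class_C 1 f -> immersion f ->
  planar_jacobian (x f) (z f) q = 0 -> planar_jacobian (y f) (z f) q = 0 ->
  planar_jacobian (y f) (x f) q != 0.
Proof.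
move=> Cf inj; have [df _] := Cf.
have jac (a b : E11 R -> R) (fa fb : R * R -> R) :
    (forall d, a ('D_d f q) = 'D_d fa q) -> (forall d, b ('D_d f q) = 'D_d fb q) ->
    a ('D_(1, 0) f q) * b ('D_(0, 1) f q) - a ('D_(0, 1) f q) * b ('D_(1, 0) f q)
    = planar_jacobian fa fb q.
  move=> ha hb; apply: (congr2 (fun r s : R => r - s));
    by apply: (congr2 (fun r s : R => r * s)); [exact: ha|exact: hb].
have Dx d : ('D_d f q).1.1 = 'D_d (x f) q by exact: derive_x.
have Dy d : ('D_d f q).1.2 = 'D_d (y f) q by exact: derive_y.
have Dz d : ('D_d f q).2 = 'D_d (z f) q by exact: derive_z.
move=> xz yz.
have ind r s := @immersion_independent f q r s Cf inj.
have := independent_minors ind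
  (etrans (jac (fun p => p.1.1) (fun p => p.2) _ _ Dx Dz) xz)
  (etrans (jac (fun p => p.1.2) (fun p => p.2) _ _ Dy Dz) yz).
apply: contra => /eqP yx; apply/eqP.
exact: (etrans (jac (fun p => p.1.2) (fun p => p.1.1) _ _ Dy Dx) yx).
Qed.

Lemma planar_jacobian_cst (a b : R * R -> R) (k : R) q :
  (forall p, b p = k) -> planar_jacobian a b q = 0 /\ planar_jacobian b a q = 0.
Proof.
move=> bk; have -> : b = cst k by apply/funext.
have D0 d : 'D_d (cst k : R * R -> R) q = 0 by exact: derive_cst.
rewrite /planar_jacobian (D0 (1, 0)) (D0 (0, 1)).
by rewrite !mulr0 !mul0r subrr.
Qed.

Lemma calibrated_of_fluxX_eq0 f : class_C 1 f ->
  (forall q, fluxX f q = 0) -> (forall q, fluxY f q != 0) ->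
  exists2 s : R, s ^+ 2 = 1 & calibrated 0 s f.
Proof.
move=> Cf f1 f2; have [s s1 sf] := constant_sign (fluxY_continuous Cf) f2.
exists s => // q; have fE : flux 0 s f q = s * fluxY f q.
  by rewrite /flux mul0r add0r.
split; rewrite fE; [exact: sf|by rewrite mulr0; exact: f1|].
by rewrite mulrAC -expr2 s1 mul1r.
Qed.

Lemma calibrated_of_fluxY_eq0 f : class_C 1 f ->
  (forall q, fluxY f q = 0) -> (forall q, fluxX f q != 0) ->
  exists2 s : R, s ^+ 2 = 1 & calibrated s 0 f.
Proof.
move=> Cf f2 f1; have [s s1 sf] := constant_sign (fluxX_continuous Cf) f1.
exists s => // q; have fE : flux s 0 f q = s * fluxX f q.
  by rewrite /flux mul0r addr0.
split; rewrite fE; [exact: sf| |by rewrite mulr0; exact: f2].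
by rewrite mulrAC -expr2 s1 mul1r.
Qed.

(** The last clause makes the straight lines in the direction J(e) remain in the
    surface; they are the leaves of the foliation. *)
Definition calibrated_surface S : Prop := plane_surface S /\
  forall f, parametrizes f S -> exists e1 e2 : R,
    [/\ e1 ^+ 2 + e2 ^+ 2 = 1, e1 * e2 = 0, calibrated e1 e2 f &
        forall p (t : R), S p -> S (t *: (- e2 *: fieldX p + e1 *: fieldY p) + p)].

Lemma calibrated_plane_x (c : R) : calibrated_surface [set p : E11 R | p.1.1 + c = 0].
Proof.
split; first exact: plane_surface_x.
move=> f [C2 inj fS _]; have Cf := class_C2_C1 C2; have [df _] := Cf.
have xc q : (f q).1.1 = - c.
  have : [set p : E11 R | p.1.1 + c = 0] (f q) by rewrite -fS; exists q.
  by move=> /eqP; rewrite addr_eq0 => /eqP.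
have j0 (a : R * R -> R) q := planar_jacobian_cst a q xc.
have f10 q : fluxX f q = 0.
  by rewrite (fluxXE (df q)); have [] := j0 (y f) q.
have f20 q : fluxY f q != 0.
  rewrite (fluxYE (df q)); have [_ xz] := j0 (z f) q; have [yx _] := j0 (y f) q.
  have := immersion_jacobian (q := q) Cf inj xz.
  rewrite xz mulr0 add0r yx eqxx => yz.
  apply/negP; rewrite !mulf_eq0 invr_eq0 sqrtr_eq0 gt_eqF ?expR_gt0//= lern0/= orbF.
  by move/eqP/yz.
have [s s1 cal] := calibrated_of_fluxX_eq0 Cf f10 f20.
exists 0, s; split; rewrite ?mul0r ?expr0n/= ?add0r// => p t /= pc.
by rewrite scale0r addr0 !scaler0 add0r.
Qed.

Lemma calibrated_plane_y (c : R) : calibrated_surface [set p : E11 R | p.1.2 + c = 0].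
Proof.
split; first exact: plane_surface_y.
move=> f [C2 inj fS _]; have Cf := class_C2_C1 C2; have [df _] := Cf.
have yc q : (f q).1.2 = - c.
  have : [set p : E11 R | p.1.2 + c = 0] (f q) by rewrite -fS; exists q.
  by move=> /eqP; rewrite addr_eq0 => /eqP.
have j0 (a : R * R -> R) q := planar_jacobian_cst a q yc.
have f10 q : fluxX f q = 0.
  by rewrite (fluxXE (df q)); have [] := j0 (x f) q.
have f20 q : fluxY f q != 0.
  rewrite (fluxYE (df q)); have [_ yz] := j0 (z f) q; have [_ yx] := j0 (x f) q.
  have := fun xz => immersion_jacobian (q := q) Cf inj xz yz.
  rewrite yz mulr0 addr0 yx eqxx => xz.
  apply/negP; rewrite !mulf_eq0 invr_eq0 sqrtr_eq0 gt_eqF ?expR_gt0//= lern0/= orbF.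
  by move/eqP/xz.
have [s s1 cal] := calibrated_of_fluxX_eq0 Cf f10 f20.
exists 0, s; split; rewrite ?mul0r ?expr0n/= ?add0r// => p t /= pc.
by rewrite scale0r addr0 !scaler0 add0r.
Qed.

Lemma calibrated_plane_z (c : R) : calibrated_surface [set p : E11 R | p.2 + c = 0].
Proof.
split; first exact: plane_surface_z.
move=> f [C2 inj fS _]; have Cf := class_C2_C1 C2; have [df _] := Cf.
have zc q : (f q).2 = - c.
  have : [set p : E11 R | p.2 + c = 0] (f q) by rewrite -fS; exists q.
  by move=> /eqP; rewrite addr_eq0 => /eqP.
have j0 (a : R * R -> R) q := planar_jacobian_cst a q zc.
have f20 q : fluxY f q = 0.
  rewrite (fluxYE (df q)); have [-> _] := j0 (x f) q; have [-> _] := j0 (y f) q.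
  by rewrite !mulr0 addr0 mul0r.
have f10 q : fluxX f q != 0.
  rewrite (fluxXE (df q)); have [xz _] := j0 (x f) q; have [yz _] := j0 (y f) q.
  exact: immersion_jacobian.
have [s s1 cal] := calibrated_of_fluxY_eq0 Cf f20 f10.
exists s, 0; split; rewrite ?mulr0 ?expr0n/= ?addr0// => p t /= pc.
by rewrite oppr0 scale0r add0r !scaler0 add0r.
Qed.

(** Everything required of the planes follows from the calibration alone. *)
Lemma calibrated_surface_properties S : calibrated_surface S ->
  [/\ area_stationary S, foliated_by_sr_geodesics S & area_minimizing S].
Proof.
move=> [pS calS]; split; (split; first exact: pS) => f fS;
  have [C2 _ rf _] := fS; have Cf := class_C2_C1 C2;
  have [e1 [e2 [e12 e1e2 cal flow]]] := calS f fS.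
- move=> K phi cK vphi; exact: (calibrated_stationary e12 Cf cal cK vphi).
- split=> [q _|I g gI]; last exact: (calibrated_geodesic e12 e1e2 cal gI).
  exists setT, (fun t => t *: (- e2 *: fieldX (f q) + e1 *: fieldY (f q)) + f q).
  split; [|by []|by rewrite scale0r add0r].
  exact: (calibrated_integral_curve e12 e1e2 Cf cal q rf flow).
- move=> K F cK [CF _ Ff].
  rewrite (sr_areaE Cf cK) (sr_areaE CF cK) lee_fin.
  exact: (calibrated_minimizing e12 CF Cf cK cal Ff).
Qed.

End Planes.

Theorem proposition5p1 (R : realType) (c : R) (S : set (E11 R)) :
  [\/ S = [set p : E11 R | p.1.1 + c = 0],
      S = [set p : E11 R | p.1.2 + c = 0]
    | S = [set p : E11 R | p.2 + c = 0]] ->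
  [/\ area_stationary S, foliated_by_sr_geodesics S & area_minimizing S].
Proof.
case=> ->; apply: calibrated_surface_properties.
- exact: calibrated_plane_x.
- exact: calibrated_plane_y.
- exact: calibrated_plane_z.
Qed.
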